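(* Let $(\mathsf X,\mathsf A,\{\mathsf A(x)\}_{x\in\mathsf X},Q,c)$ be a Markov control process with set of feasible pairs $\mathsf K$, and let $\mathcal R_{x,a}(v):=\ln\int_{\mathsf X}e^{v(y)}\,Q(dy|x,a)$ be the entropic map with parameter $\lambda=1$. Suppose there are a Borel function $w_1:\mathsf X\to[1,\infty)$ and constants $\gamma_1\in(0,1)$, $K_1>0$ such that: (i) $\mathcal R_{x,a}(w_1)\le\gamma_1w_1(x)+K_1$ for all $(x,a)\in\mathsf K$; (ii) (local Doeblin condition) for every nonempty level set $\mathsf C=\{x\in\mathsf X:w_1(x)\le R\}$, $R>0$, there exist a measure $\mu_{\mathsf C}$ on $\mathcal B(\mathsf X)$ and constants $\lambda_{\mathsf C}^+,\lambda_{\mathsf C}^->0$ such that $\mu_{\mathsf C}(\mathsf C)>0$ and $\lambda_{\mathsf C}^-\mu_{\mathsf C}(\mathsf D\cap\mathsf C)\le Q_{x,a}(\mathsf D\cap\mathsf C)\le\lambda_{\mathsf C}^+\mu_{\mathsf C}(\mathsf D\cap\mathsf C)$ for all $x\in\mathsf C$, $a\in\mathsf A(x)$, $\mathsf D\in\mathcal B(\mathsf X)$; (iii) for some $q\in(0,1)$ and $C>0$, $|c(x,a)|\le C\,w_1(x)^q$ for all $(x,a)\in\mathsf K$. Then for any $p\in(q,1)$, with $w_0:=w_1^p$ and $\mathcal T_{x,a}(v):=c(x,a)+\mathcal R_{x,a}(v)$, there exist constants $\gamma_0\in(0,1)$, $K_0>0$ and $K>K_0$ such that (A1) $\max\{\mathcal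 T_{x,a}(w_0),-\mathcal T_{x,a}(-w_0)\}\le\gamma_0w_0(x)+K_0$ for all $(x,a)\in\mathsf K$; (A2) $\mathcal R_{x,a}(w_0+K)-\mathcal R_{x,a}(v)+\mathcal R_{y,b}(v)-\mathcal R_{y,b}(-w_0-K)\ge2K_0$ for all $v\in\mathscr B_{1+w_0}$ with $|v|\le w_0+K$, all $x,y\in\{x:w_0(x)\le\frac{2K_0}{1-\gamma_0}\}$, $a\in\mathsf A(x)$, $b\in\mathsf A(y)$; and, with $w:=1+K^{-1}w_0$, (B1) there exist $\gamma\in(0,1)$, $\bar K>0$ and an upper envelope $\bar{\mathcal R}^{(w,K)}$ of $\mathcal R$ given the bound $K$ such that $\bar{\mathcal R}^{(w,K)}_{x,a}(w_0)\le\gamma w_0(x)+\bar K$ for all $(x,a)\in\mathsf K$; (B2) there exist $\alpha\in(0,1)$, a Borel probability measure $\mu$ on $\mathsf X$ with $\int w_0\,d\mu<\infty$, and $R>\frac{2\bar K}{1-\gamma}$ such that $\bar{\mathcal R}^{(w,K)}_{x,a}(v)-\bar{\mathcal R}^{(w,K)}_{x,a}(u)\ge\alpha\int(v-u)\,d\mu$ for all $x$ with $w_0(x)\le R$, all $a\in\mathsf A(x)$ and all $v\ge u$ in $\mathscr B_{1+w_0}$.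
   Context: Markov control process: $\mathsf X$ (states) and $\mathsf A$ (actions) are Borel spaces (Borel subsets of complete separable metric spaces); for each $x\in\mathsf X$, $\mathsf A(x)\subset\mathsf A$ is a nonempty Borel set of feasible actions; $\mathsf K:=\{(x,a):x\in\mathsf X,a\in\mathsf A(x)\}$ is a Borel subset of $\mathsf X\times\mathsf A$; $Q$ is a stochastic kernel on $\mathsf X$ given $\mathsf K$, with $Q_{x,a}(\cdot):=Q(\cdot|x,a)$; $c:\mathsf K\to\mathbb R$ is Borel measurable. Weighted spaces: for measurable $w:\mathsf X\to[1,\infty)$, $\|u\|_w:=\sup_x |u(x)|/w(x)$, $\mathscr B_w$ is the space of real-valued Borel functions on $\mathsf X$ with $\|u\|_w<\infty$, and $\|v\|_{s,w}:=\sup_{x\ne y}\frac{|v(x)-v(y)|}{w(x)+w(y)}$; $\mathscr B_w^{(K)}:=\{v\in\mathscr B_w:\|v\|_{s,w}\le K\}$. Note $\mathscr B_{1+\beta w_0}=\mathscr B_{1+w_0}$ for every $\beta>0$. Real numbers are identified with constant functions; $\le$ between functions is pointwise. Risk map: let $\mathscr P$ be the set of Borel probability measures on $\mathsf X$. A risk measure is $\nu:\mathscr B_w\times\mathscr P\to\mathbb R\cup\{\pm\infty\}$ such that for each $\mu\in\mathscr P$: $\nu(v,\mu)\le\nu(u,\mu)$ whenever $v\le u$; $\nu(v+r,\mu)=\nu(v,\mu)+r$ for $r\in\mathbb R$; $\nu(0,\mu)=0$. A risk map on $\mathscr B_w$ is $\mathcal R:\mathscr B_w\times\mathsf K\to\mathbb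 R$, written $\mathcal R_{x,a}(v)=\mathcal R(v|x,a)$, such that for each $(x,a)$ one has $\mathcal R_{x,a}(\cdot)=\nu(\cdot,Q_{x,a})$ for some risk measure $\nu$, and $(x,a)\mapsto\mathcal R(v|x,a)$ is Borel measurable for each $v$. It is coherent if each $\mathcal R_{x,a}$ is convex and satisfies $\mathcal R_{x,a}(\lambda v)=\lambda\mathcal R_{x,a}(v)$ for $\lambda\ge0$. Upper envelope: a coherent risk map $\bar{\mathcal R}^{(w,K)}$ on $\mathscr B_w$ is an upper envelope of $\mathcal R$ given the bound $K>0$ if $\mathcal R_{x,a}(v)-\mathcal R_{x,a}(u)\le\bar{\mathcal R}^{(w,K)}_{x,a}(v-u)$ for all $v,u\in\mathscr B_w^{(K)}$ and $(x,a)\in\mathsf K$. *)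

(* Defs.v *)
From HB Require Import structures.
From mathcomp Require Import all_boot all_order all_algebra.
From mathcomp Require Import all_classical all_reals all_analysis.
From mathcomp Require Import measurable_realfun.

Set Implicit Arguments.
Unset Strict Implicit.
Unset Printing Implicit Defensive.

Import Order.TTheory GRing.Theory Num.Theory.
Import numFieldNormedType.Exports.

Local Open Scope classical_set_scope.
Local Open Scope ring_scope.

Definition complete_separable_metric (R : realType) (S : metricType R) : Prop :=
  (forall F : set_system S, ProperFilter F -> cauchy F -> exists x : S, F --> x)
  /\ (exists2 D : set S, countable D & dense D).

Definition borel_set (T : topologicalType) : set (set T) :=
  <<s [set U : set T | open U] >>.

(* X is identified, through the injection i, with the Borel subset [range i] of
   S, and its sigma-algebra with the trace on it of the Borel sets of S. *)
Definition borel_space (R : realType) (d : measure_display)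
    (X : measurableType d) : Prop :=
  exists (S : metricType R) (i : X -> S),
    [/\ complete_separable_metric S,
        injective i,
        borel_set (range i) &
        forall D : set X,
          measurable D <-> exists2 B : set S, borel_set B & D = i @^-1` B].

Definition feasible_pairs (X A : Type) (Af : X -> set A) : set (X * A) :=
  [set xa | Af xa.1 xa.2].

(* [transition] and [cost] are total functions, but only their values on the set of
   feasible pairs are constrained or used. X and A are nonempty because every
   measurableType is pointed. *)
Record markov_control_process (R : realType) (dX dA : measure_display)
    (X : measurableType dX) (A : measurableType dA) := MarkovControlProcess {
  feasible : X -> set A ;
  transition : X * A -> probability X R ;
  cost : X * A -> R ;
  states_borel : borel_space R X ;
  actions_borel : borel_space R A ;
  feasible_neq0 : forall x, feasible x !=set0 ;
  feasible_measurable : forall x, measurable (feasible x) ;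
  feasible_pairs_measurable : measurable (feasible_pairs feasible) ;
  transition_measurable : forall D : set X, measurable D ->
    measurable_fun (feasible_pairs feasible) (transition ^~ D) ;
  cost_measurable : measurable_fun (feasible_pairs feasible) cost
}.

Section weighted_spaces.
Variables (R : realType) (d : measure_display) (X : measurableType d).
Implicit Types (w u v : X -> R) (K : R).

Definition wnorm w u : \bar R :=
  ereal_sup [set (`|u x| / w x)%:E | x in [set: X]].

Definition wspace w : set (X -> R) :=
  [set u | measurable_fun [set: X] u /\ (wnorm w u < +oo)%E].

(* The supremum is -oo, hence below every K, when X is a singleton. *)
Definition wseminorm w v : \bar R :=
  ereal_sup [set (`|v p.1 - v p.2| / (w p.1 + w p.2))%:E
            | p in [set p : X * X | p.1 <> p.2]].

Definition wspace_bounded w K : set (X -> R) :=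
  [set v | wspace w v /\ (wseminorm w v <= K%:E)%E].

End weighted_spaces.

Section risk_maps.
Variables (R : realType) (dX dA : measure_display).
Variables (X : measurableType dX) (A : measurableType dA).
Variable M : markov_control_process R X A.
Implicit Types (w u v : X -> R).

Local Notation KK := (feasible_pairs (feasible M)).
Local Notation Q := (transition M).

Definition risk_measure w (nu : (X -> R) -> probability X R -> \bar R) : Prop :=
  forall mu : probability X R,
  [/\ forall u v, wspace w u -> wspace w v -> (forall x, v x <= u x) ->
        (nu v mu <= nu u mu)%E,
      forall v (r : R), wspace w v ->
        nu (fun x => v x + r) mu = (nu v mu + r%:E)%E &
      nu (fun=> 0) mu = 0%E].

Definition risk_map w (rho : X * A -> (X -> R) -> R) : Prop :=
  (forall xa, KK xa -> exists2 nu, risk_measure w nu &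
     forall v, wspace w v -> (rho xa v)%:E = nu v (Q xa)) /\
  (forall v, wspace w v -> measurable_fun KK (fun xa => rho xa v)).

Definition coherent_risk_map w (rho : X * A -> (X -> R) -> R) : Prop :=
  [/\ risk_map w rho,
      forall xa u v (t : R), KK xa -> wspace w u -> wspace w v ->
        0 <= t <= 1 ->
        rho xa (fun x => t * u x + (1 - t) * v x)
          <= t * rho xa u + (1 - t) * rho xa v &
      forall xa v (l : R), KK xa -> wspace w v -> 0 <= l ->
        rho xa (fun x => l * v x) = l * rho xa v].

(* Extended-real valued: +oo exactly when exp v is not integrable. *)
Definition entropic (xa : X * A) v : \bar R :=
  lne (\int[Q xa]_y (expR (v y))%:E)%E.

(* For the entropic map, finite on B_w under the drift condition, the extended
   difference below is a difference of reals. *)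
Definition upper_envelope (rho : X * A -> (X -> R) -> \bar R) w (K : R)
    (rhobar : X * A -> (X -> R) -> R) : Prop :=
  coherent_risk_map w rhobar /\
  (forall xa u v, KK xa -> wspace_bounded w K u -> wspace_bounded w K v ->
    (rho xa v - rho xa u <= (rhobar xa (fun x => v x - u x))%:E)%E).

Definition local_doeblin (w1 : X -> R) : Prop :=
  forall r : R, 0 < r ->
  let C := [set x | w1 x <= r] in
  C !=set0 ->
  exists (mu : {measure set X -> \bar R}) (lp lm : R),
    [/\ 0 < lp, 0 < lm, (0 < mu C)%E &
      forall x a (D : set X), C x -> feasible M x a -> measurable D ->
        (lm%:E * mu (D `&` C) <= Q (x, a) (D `&` C))%E /\
        (Q (x, a) (D `&` C) <= lp%:E * mu (D `&` C))%E].

End risk_maps.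

(* Main.v *)
(**
  Write [w0 = w1 `^ p] and [m = gamma1 w1(x) + K1]. Concavity of the power and
  convexity of the exponential give [\int e^w0 dQ <= e^(m `^ p)], and Jensen's
  inequality gives [\int e^(- w0) dQ >= e^(- m `^ p)]; since [m `^ p] is at most
  [gamma1 `^ p w0(x) + K1 `^ p] and the cost is of lower order than [w0], this is
  (A1). For (A2), the mass of [e^w0] outside a large level set of [w1] is
  negligible because [w0] is of lower order than [w1], while on the level set the
  Doeblin condition makes the kernels pairwise comparable up to a constant; [K]
  is chosen last, to beat that constant.

  If [v] has [w]-seminorm at most [K], the density [e^v / \int e^v dQ] lies
  between [1 / h] and [h], where [h = e^(2 K + m `^ p + w0)]. The upper envelope
  is the supremum of [\int f rho dQ] over all densities [rho] between these
  bounds, taken in its dual form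
  [inf_t (t + \int max(h (f - t), (f - t) / h) dQ)],
  which is visibly coherent and, as an infimum over rational [t], measurable in
  [(x, a)]. Taking [t = delta w0(x)] with [gamma1 `^ p < delta < 1] gives (B1),
  since [e^w1] dominates [h w0] where [w0 > t]. The slopes of the integrand are
  at least [1 / h], which together with the Doeblin condition gives (B2) for a
  conditioned transition probability [mu].
*)

Require Import Defs.
From HB Require Import structures.
From mathcomp Require Import all_boot all_order all_algebra.
From mathcomp Require Import all_classical all_reals all_analysis.
From mathcomp Require Import measurable_realfun.
From mathcomp Require Import ring lra.

Set Implicit Arguments.
Unset Strict Implicit.
Unset Printing Implicit Defensive.

Import Order.TTheory GRing.Theory Num.Theory.
Import numFieldNormedType.Exports.

Local Open Scope classical_set_scope.
Local Open Scope ring_scope.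

(** * Elementary inequalities for powers and exponentials *)

Section real_inequalities.
Context {R : realType}.
Implicit Types (a b c m p s t theta x y : R).

Lemma expR_le_chord theta t : 0 <= theta <= 1 ->
  expR (theta * t) <= 1 + theta * (expR t - 1).
Proof.
move=> /andP[th0 th1].
have e0 := expR_gt0 (theta * t).
(* tangent lines of [expR] at [theta * t], evaluated at [t] and at [0] *)
have ht : expR (theta * t) * (1 + (1 - theta) * t) <= expR t.
  have -> : expR t = expR (theta * t) * expR ((1 - theta) * t).
    by rewrite -expRD; congr expR; ring.
  by rewrite ler_pM2l// expR_ge1Dx.
have h0 : expR (theta * t) * (1 - theta * t) <= 1.
  rewrite [leRHS](_ : 1 = expR (theta * t) * expR (- (theta * t))).
    by rewrite ler_pM2l// expR_ge1Dx.
  by rewrite -expRD subrr expR0.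
have := lerD (ler_wpM2l th0 ht) (ler_wpM2l (_ : 0 <= 1 - theta) h0).
rewrite subr_ge0 => /(_ th1); lra.
Qed.

(** With [s = m * expR t] and [theta = p] this is the chord bound [expR_le_chord], scaled by m^p. *)
Lemma powR_le_tangent p m s : 0 <= p <= 1 -> 0 < m -> 0 < s ->
  s `^ p <= m `^ p + p * m `^ (p - 1) * (s - m).
Proof.
move=> p01 m0 s0.
have sm0 : 0 < s / m by rewrite divr_gt0.
have -> : s `^ p = m `^ p * (s / m) `^ p.
  rewrite -powRM ?(ltW m0) ?(ltW sm0)//.
  by rewrite mulrCA divff ?mulr1// gt_eqF.
have -> : m `^ (p - 1) = m `^ p / m.
  by rewrite powRB ?powRr1 ?(ltW m0)//; apply/implyP => _; rewrite gt_eqF.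
have -> : m `^ p + p * (m `^ p / m) * (s - m) =
    m `^ p * (1 + p * (s / m - 1)).
  by field; rewrite gt_eqF.
rewrite ler_wpM2l ?powR_ge0//.
have := expR_le_chord (ln (s / m)) p01.
by rewrite lnK ?posrE// /powR gt_eqF.
Qed.

(** A fraction in (0, 1] is at most its own [p]-th power; this is applied to [a / (a + b)] and
    [b / (a + b)], which sum to 1. *)
Lemma powR_subadditive p a b : 0 <= p <= 1 -> 0 < a -> 0 < b ->
  (a + b) `^ p <= a `^ p + b `^ p.
Proof.
move=> /andP[p0 p1] a0 b0; have ab0 : 0 < a + b by rewrite addr_gt0.
have le c : 0 < c -> c <= a + b -> (a + b) `^ p * (c / (a + b)) <= c `^ p.
  move=> c0 cab.
  have cE : (a + b) * (c / (a + b)) = c by field; rewrite gt_eqF.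
  have c1 : 0 < c / (a + b) <= 1 by rewrite divr_gt0//= ler_pdivrMr ?mul1r.
  rewrite -[in leRHS]cE powRM ?(ltW ab0)//; last by case/andP : c1 => /ltW.
  by rewrite ler_wpM2l ?powR_ge0// ger1_powR.
have := lerD (le _ a0 _) (le _ b0 _); rewrite lerDl lerDr (ltW a0) (ltW b0).
move=> /(_ erefl erefl); apply: le_trans; rewrite -mulrDr -mulrDl divff ?mulr1//.
by rewrite gt_eqF.
Qed.

(** The threshold [t] solves t^(b - a) = c / e: up to [t] the left side stays below the constant,
    beyond [t] the higher power wins. *)
Lemma powR_absorb (a b c e : R) : 0 <= a < b -> 0 <= c -> 0 < e ->
  exists2 D, 0 <= D & forall s, 1 <= s -> c * s `^ a <= e * s `^ b + D.
Proof.
move=> /andP[a0 ab] c0 e0; have ba0 : 0 < b - a by rewrite subr_gt0.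
pose t := (c / e) `^ (b - a)^-1.
exists (c * t `^ a) => [|s s1]; first by rewrite mulr_ge0// powR_ge0.
have s0 : 0 < s by apply: lt_le_trans s1.
have [st|ts] := leP s t.
  rewrite -[leLHS]add0r lerD ?mulr_ge0 ?powR_ge0 ?(ltW e0)// ler_wpM2l//.
  by rewrite ge0_ler_powR// ?nnegrE ?powR_ge0// ltW.
rewrite -[leLHS]addr0 lerD ?mulr_ge0 ?powR_ge0//.
have -> : b = a + (b - a) by ring.
rewrite powRD; last by apply/implyP => _; rewrite gt_eqF.
rewrite mulrCA [leLHS]mulrC ler_wpM2l ?powR_ge0// mulrC -ler_pdivrMr//.
have -> : c / e = t `^ (b - a).
  by rewrite /t -powRrM mulVf ?powRr1 ?gt_eqF// divr_ge0// ltW.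
by rewrite ge0_ler_powR ?nnegrE ?powR_ge0 ?(ltW s0) ?(ltW ba0)// ltW.
Qed.

End real_inequalities.

(** * The support function of an interval of slopes *)

Section stretch.
Context {R : realType}.
Implicit Types (k l r s t : R).

(** For [k >= 1] this is the largest value of [r * s] over slopes [r] between 1/k and k. *)
Definition stretch k s : R := Num.max (k * s) (k^-1 * s).

Lemma le_stretch k r s : k^-1 <= r <= k -> r * s <= stretch k s.
Proof.
move=> /andP[kr rk]; rewrite /stretch le_max.
have [s0|s0] := leP 0 s; first by rewrite ler_wpM2r.
by apply/orP; right; rewrite ler_wnM2r// ltW.
Qed.

Lemma invr_le_ge1 k : 1 <= k -> k^-1 <= 1 <= k.
Proof. by move=> k1; rewrite k1 andbT invf_le1// (lt_le_trans ltr01). Qed.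

Lemma stretch_ge k s : 1 <= k -> s <= stretch k s.
Proof. by move=> /invr_le_ge1 k1; rewrite -{1}[s]mul1r le_stretch. Qed.

Lemma ge0_stretch k s : 1 <= k -> 0 <= s -> stretch k s = k * s.
Proof.
move=> /invr_le_ge1 /andP[k1 k2] s0; apply/max_idPl.
by rewrite ler_wpM2r// (le_trans k1).
Qed.

Lemma le0_stretch k s : 1 <= k -> s <= 0 -> stretch k s = k^-1 * s.
Proof.
move=> /invr_le_ge1 /andP[k1 k2] s0; apply/max_idPr.
by rewrite ler_wnM2r// (le_trans k1).
Qed.

Lemma stretch_incr k s t : 1 <= k -> s <= t ->
  stretch k s + k^-1 * (t - s) <= stretch k t.
Proof.
move=> /invr_le_ge1 /andP[k1 k2] st; rewrite -lerBrDr /stretch ge_max !lerBrDr.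
rewrite !le_max; apply/andP; split; apply/orP; last by right; lra.
left; rewrite -lerBrDl -mulrBr ler_wpM2r ?subr_ge0//; exact: le_trans k1 k2.
Qed.

Lemma stretchD k s t : stretch k (s + t) <= stretch k s + stretch k t.
Proof.
by rewrite /stretch ge_max !mulrDr; apply/andP; split; apply: lerD;
  rewrite le_max lexx ?orbT.
Qed.

Lemma stretchZ k l s : 0 <= l -> stretch k (l * s) = l * stretch k s.
Proof.
by move=> l0; rewrite /stretch maxr_pMr//; congr Num.max; ring.
Qed.

Lemma stretchE k s : 1 <= k ->
  stretch k s = k * Num.max s 0 - k^-1 * Num.max (- s) 0.
Proof.
move=> k1; case/orP: (le_total 0 s) => s0.
  by rewrite ge0_stretch// max_l// max_r ?oppr_le0// mulr0 subr0.
rewrite le0_stretch// max_r// max_l ?oppr_ge0// mulr0; ring.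
Qed.

Lemma norm_stretch k s : 1 <= k -> `|stretch k s| <= k * `|s|.
Proof.
move=> k1; have /andP[ki1 _] := invr_le_ge1 k1.
have k0 : 0 <= k by lra.
have [s0|s0] := leP 0 s.
  by rewrite ge0_stretch// normrM (ger0_norm k0).
rewrite le0_stretch ?(ltW s0)// normrM normfV (ger0_norm k0).
by rewrite ler_wpM2r// (le_trans ki1).
Qed.

End stretch.

(** * Real-valued integrals against a probability *)

Section real_integrals.
Context d (T : measurableType d) (R : realType) (P : probability T R).
Implicit Types (f g : T -> R).
Local Notation intg f := (P.-integrable [set: T] (EFin \o f)).

Lemma integrable_dominated f g : measurable_fun [set: T] f ->
  (forall x, `|f x| <= g x) -> intg g -> intg f.
Proof.
move=> mf fg; apply: le_integrable => //; first exact/measurable_EFinP.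
by move=> x _ /=; rewrite lee_fin (le_trans (fg x))// ler_norm.
Qed.

Lemma integrable_EFinD f g : intg f -> intg g -> intg (fun x => f x + g x).
Proof. by move=> If Ig; exact: (integrableD measurableT If Ig). Qed.

Lemma integrable_EFinB f g : intg f -> intg g -> intg (fun x => f x - g x).
Proof. by move=> If Ig; exact: (integrableB measurableT If Ig). Qed.

Lemma integrable_EFinZ (r : R) f : intg f -> intg (fun x => r * f x).
Proof. by move=> If; exact: (integrableZl measurableT _ If). Qed.

Lemma integrable_EFin_cst (r : R) : intg (fun=> r).
Proof. exact: finite_measure_integrable_cst. Qed.

Lemma integrable_EFin_norm f : intg f -> intg (fun x => `|f x|).
Proof. exact: integrable_norm. Qed.

Lemma measurable_integrable f : intg f -> measurable_fun [set: T] f.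
Proof. by move=> /(measurable_int P)/measurable_EFinP. Qed.

Lemma Rintegral_prob_cst (r : R) : \int[P]_x r = r.
Proof. by rewrite Rintegral_cst//= probability_setT mulr1. Qed.

Lemma Rintegral_le f g : intg f -> intg g -> (forall x, f x <= g x) ->
  \int[P]_x f x <= \int[P]_x g x.
Proof. by move=> If Ig fg; apply: le_Rintegral. Qed.

Lemma EFin_Rintegral f : intg f ->
  (\int[P]_x (f x)%:E)%E = (\int[P]_x f x)%:E.
Proof. by move=> If; rewrite fineK//; exact: integrable_fin_num. Qed.

(** The tangent line of [expR] at the mean [m] lies below [expR], and its integral is [expR m]. *)
Lemma jensen_expR f : intg f -> intg (expR \o f) ->
  expR (\int[P]_x f x) <= \int[P]_x expR (f x).
Proof.
move=> If Ief; set m := Rintegral _ _ _.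
have -> : expR m = \int[P]_x (expR m * (1 - m) + expR m * f x).
  rewrite RintegralD//; last 2 first.
  - exact: integrable_EFin_cst.
  - exact: integrable_EFinZ.
  by rewrite Rintegral_prob_cst RintegralZl// -/m; ring.
apply: Rintegral_le => //.
  apply: integrable_EFinD; first exact: integrable_EFin_cst.
  exact: integrable_EFinZ.
move=> x; rewrite (_ : f x = m + (f x - m)); last by ring.
rewrite expRD -mulrDr ler_pM2l ?expR_gt0//.
apply: le_trans (expR_ge1Dx _); rewrite le_eqVlt; apply/orP; left.
by apply/eqP; ring.
Qed.

Lemma Rintegral_expR_gt0 f : intg f -> intg (expR \o f) ->
  0 < \int[P]_x expR (f x).
Proof.
by move=> If Ief; apply: lt_le_trans (jensen_expR If Ief); rewrite expR_gt0.
Qed.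

End real_integrals.

(** * The robust expectation: coherence, monotonicity and the envelope inequality *)

Section robust_expectation.
Context d (T : measurableType d) (R : realType).
Variables (P : probability T R) (h : T -> R).
Implicit Types (f g u v : T -> R) (r t l c : R).
Local Notation intg f := (P.-integrable [set: T] (EFin \o f)).

(* By convex duality [robust f] is the supremum of [\int f rho dP] over the
   probability densities [rho] with [1 / h <= rho <= h]. *)
Definition robust_obj f t : R := t + \int[P]_x stretch (h x) (f x - t).

Definition robust f : R := inf (range (robust_obj f)).

(** Integrability against the largest allowed density [h]; since [stretch (h x) (f x)] is at most h
    |f| in absolute value, every dual objective is then a convergent integral. *)
Definition admissible f :=
  measurable_fun [set: T] f /\ intg (fun x => h x * f x).

Hypotheses (mh : measurable_fun [set: T] h) (h_ge1 : forall x, 1 <= h x).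
Hypothesis ih : intg h.

Let h_gt0 x : 0 < h x. Proof. exact: lt_le_trans (h_ge1 x). Qed.

Let mhV : measurable_fun [set: T] (fun x => (h x)^-1).
Proof.
rewrite (_ : (fun _ => _) = (fun y => y `^ (-1)) \o h).
  exact: (measurableT_comp (measurable_powR (-1)) mh).
by apply/funext => x /=; rewrite powR_inv1// ltW.
Qed.

Lemma admissible_cst r : admissible (fun=> r).
Proof.
split; first exact: measurable_cst.
rewrite (_ : (fun _ => _) = fun x => r * h x); last first.
  by apply/funext => x; rewrite mulrC.
exact: integrable_EFinZ.
Qed.

Lemma admissibleD f g : admissible f -> admissible g ->
  admissible (fun x => f x + g x).
Proof.
move=> [mf hf] [mg hg]; split; first exact: measurable_funD.
under eq_fun do rewrite mulrDr.
exact: integrable_EFinD.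
Qed.

Lemma admissibleZ r f : admissible f -> admissible (fun x => r * f x).
Proof.
move=> [mf hf]; split; first exact: measurable_funM.
under eq_fun do rewrite mulrCA.
exact: integrable_EFinZ.
Qed.

Lemma admissibleB f g : admissible f -> admissible g ->
  admissible (fun x => f x - g x).
Proof.
move=> af /(admissibleZ (-1)) ag; have := admissibleD af ag.
by under eq_fun do rewrite mulN1r.
Qed.

Lemma admissible_integrable f : admissible f -> intg f.
Proof.
move=> [mf hf]; apply: (@integrable_dominated _ _ _ P _ (fun x => `|h x * f x|)) => //.
  by move=> x; rewrite normrM -[leLHS]mul1r ler_wpM2r// ger0_norm// ltW.
exact: integrable_EFin_norm.
Qed.

Lemma admissible_div f : admissible f -> intg (fun x => (h x)^-1 * f x).
Proof.
move=> af; have [mf _] := af.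
apply: (@integrable_dominated _ _ _ P _ (fun x => `|f x|)).
- exact: measurable_funM.
- move=> x; rewrite normrM -[leRHS]mul1r ler_wpM2r// ger0_norm ?invr_ge0 ?(ltW (h_gt0 x))//.
  by case/andP : (invr_le_ge1 (h_ge1 x)).
- exact/integrable_EFin_norm/admissible_integrable.
Qed.

Lemma stretch_integrable f : admissible f ->
  intg (fun x => stretch (h x) (f x)).
Proof.
move=> [mf hf]; apply: (@integrable_dominated _ _ _ P _ (fun x => `|h x * f x|)).
- by apply: measurable_maxr; exact: measurable_funM.
- move=> x; rewrite (le_trans (norm_stretch _ (h_ge1 x)))// normrM.
  by rewrite (ger0_norm (ltW (h_gt0 x))).
- exact: integrable_EFin_norm.
Qed.

Let stretch_shift_integrable f t : admissible f ->
  intg (fun x => stretch (h x) (f x - t)).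
Proof.
move=> af; apply: (@stretch_integrable (fun x => f x - t)).
exact: admissibleB (admissible_cst t).
Qed.

(** Slope 1 is always allowed, so each objective dominates the plain mean. This is what bounds the
    set under [inf] from below. *)
Lemma robust_obj_ge f t : admissible f -> \int[P]_x f x <= robust_obj f t.
Proof.
move=> af; have If := admissible_integrable af.
have -> : \int[P]_x f x = t + \int[P]_x (f x - t).
  rewrite RintegralB//; last exact: integrable_EFin_cst.
  by rewrite Rintegral_prob_cst; ring.
rewrite lerD2l; apply: Rintegral_le => //.
- by apply: integrable_EFinB => //; exact: integrable_EFin_cst.
- exact: stretch_shift_integrable.
- by move=> x; exact: stretch_ge.
Qed.

Lemma robust_obj_has_lbound f : admissible f -> has_lbound (range (robust_obj f)).
Proof.
by move=> af; exists (\int[P]_x f x) => _ [t _ <-]; exact: robust_obj_ge.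
Qed.

Lemma robust_le f t : admissible f -> robust f <= robust_obj f t.
Proof. by move=> af; apply: ge_inf; [exact: robust_obj_has_lbound|exists t]. Qed.

Lemma le_robust f c : (forall t, c <= robust_obj f t) -> c <= robust f.
Proof.
move=> cf; apply: lb_le_inf; first by exists (robust_obj f 0), 0.
by move=> _ [t _ <-].
Qed.

Lemma robust_ge f : admissible f -> \int[P]_x f x <= robust f.
Proof. by move=> af; apply: le_robust => t; exact: robust_obj_ge. Qed.

(* All slopes of [stretch (h x)] are at least [1 / h x]. *)
Lemma robust_incr u v : admissible u -> admissible v ->
  (forall x, u x <= v x) ->
  robust u + \int[P]_x ((h x)^-1 * (v x - u x)) <= robust v.
Proof.
move=> au av uv; apply: le_robust => t.
have Id := admissible_div (admissibleB av au).
apply: (@le_trans _ _ (robust_obj u t + \int[P]_x ((h x)^-1 * (v x - u x)))).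
  by rewrite lerD2r robust_le.
rewrite /robust_obj -addrA lerD2l -RintegralD//; last exact: stretch_shift_integrable.
apply: Rintegral_le.
- by apply: integrable_EFinD => //; exact: stretch_shift_integrable.
- exact: stretch_shift_integrable.
- move=> x; have := @stretch_incr _ (h x) (u x - t) (v x - t) (h_ge1 x).
  rewrite lerD2r uv => /(_ erefl); apply: le_trans.
  by rewrite lerD2l (_ : v x - t - _ = v x - u x)//; ring.
Qed.

Lemma robust_mono u v : admissible u -> admissible v ->
  (forall x, u x <= v x) -> robust u <= robust v.
Proof.
move=> au av uv; apply: le_trans (robust_incr au av uv).
rewrite lerDl Rintegral_ge0// => x _.
by rewrite mulr_ge0 ?invr_ge0 ?subr_ge0// ltW.
Qed.

(** Adding a constant to [f] shifts the dual variable by the same constant. One inequality suffices: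
    the other is the same one for the shift by [- r]. *)
Lemma robust_translation f r : admissible f ->
  robust (fun x => f x + r) = robust f + r.
Proof.
have le g s : admissible g -> robust (fun x => g x + s) <= robust g + s.
  move=> ag; rewrite -lerBlDr; apply: le_robust => t; rewrite lerBlDr.
  have ags := admissibleD ag (admissible_cst s).
  apply: (le_trans (robust_le (t + s) ags)).
  rewrite /robust_obj addrAC lerD2r lerD2l.
  rewrite (@eq_Rintegral _ _ _ _ _ (fun x => stretch (h x) (g x - t)))// => x _.
  by congr stretch; ring.
move=> af; apply/eqP; rewrite eq_le le//= -lerBrDr.
have := le _ (- r) (admissibleD af (admissible_cst r)).
by under eq_fun do rewrite addrK.
Qed.

Lemma robust0 : robust (fun=> 0) = 0.
Proof.
have a0 := admissible_cst 0; apply/eqP; rewrite eq_le; apply/andP; split.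
  apply: (le_trans (robust_le 0 a0)); rewrite /robust_obj add0r.
  rewrite (@eq_Rintegral _ _ _ _ _ (fun=> 0)); last first.
    by move=> x _ /=; rewrite subr0 /stretch !mulr0 maxxx.
  by rewrite Rintegral_prob_cst.
by apply: le_trans (robust_ge a0); rewrite Rintegral_prob_cst.
Qed.

Lemma robustZ f l : admissible f -> 0 <= l ->
  robust (fun x => l * f x) = l * robust f.
Proof.
have le g c : admissible g -> 0 < c -> robust (fun x => c * g x) <= c * robust g.
  move=> ag c0; rewrite mulrC -ler_pdivrMr//; apply: le_robust => t.
  rewrite ler_pdivrMr// mulrC; apply: (le_trans (robust_le (c * t) _)).
    exact: admissibleZ.
  rewrite /robust_obj mulrDr lerD2l -RintegralZl//; last exact: stretch_shift_integrable.
  by under eq_Rintegral => x _ do rewrite -mulrBr (stretchZ _ _ (ltW c0)).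
move=> af; rewrite le_eqVlt => /predU1P[<-|l0].
  by rewrite mul0r; under eq_fun do rewrite mul0r; exact: robust0.
apply/eqP; rewrite eq_le le//= mulrC -ler_pdivlMr// mulrC.
have := le _ l^-1 (admissibleZ l af); rewrite invr_gt0 => /(_ l0).
by under eq_fun do rewrite mulKf ?gt_eqF//.
Qed.

(** Dual variables add up: by subadditivity of [stretch], the objective of the sum at [s + t] is at
    most the sum of the objectives at [s] and at [t]. *)
Lemma robustD u v : admissible u -> admissible v ->
  robust (fun x => u x + v x) <= robust u + robust v.
Proof.
move=> au av; rewrite -lerBlDr; apply: le_robust => s.
rewrite lerBlDr -lerBlDl; apply: le_robust => t; rewrite lerBlDl.
apply: (le_trans (robust_le (s + t) (admissibleD au av))).
rewrite /robust_obj addrACA lerD2l -RintegralD//; try exact: stretch_shift_integrable.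
apply: Rintegral_le.
- exact: (stretch_shift_integrable _ (admissibleD au av)).
- by apply: integrable_EFinD; exact: stretch_shift_integrable.
- move=> x; apply: le_trans (stretchD _ _ _).
  by rewrite (_ : u x + v x - _ = u x - s + (v x - t))//; ring.
Qed.

Lemma robust_convex u v t : admissible u -> admissible v -> 0 <= t <= 1 ->
  robust (fun x => t * u x + (1 - t) * v x) <= t * robust u + (1 - t) * robust v.
Proof.
move=> au av /andP[t0 t1]; rewrite -subr_ge0 in t1.
by rewrite -!robustZ// robustD//; exact: admissibleZ.
Qed.

(* [expR v] renormalised is an admissible density, and the entropic map lies
   below its linearisation at [v]. *)
Lemma robust_envelope u v (V : R) : V = \int[P]_x expR (v x) ->
    admissible u -> admissible v ->
    intg (expR \o u) -> intg (expR \o v) ->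
    (forall x, expR (v x) <= V * h x) -> (forall x, V <= h x * expR (v x)) ->
  ln V - ln (\int[P]_x expR (u x)) <= robust (fun x => v x - u x).
Proof.
move=> VE au av Iu Iv vh hv; apply: le_robust => t.
have avu := admissibleB av au.
move mE : (robust_obj _ _) => m.
have V0 : 0 < V.
  by rewrite VE; apply: Rintegral_expR_gt0 => //; exact: admissible_integrable.
have U0 : 0 < \int[P]_x expR (u x).
  by apply: Rintegral_expR_gt0 => //; exact: admissible_integrable.
pose phi x := stretch (h x) (v x - u x - t).
have Iphi : intg phi by exact: (stretch_shift_integrable _ avu).
(* The exponentiated form of the goal, [m] being the objective at [t]. *)
suff : expR (- m) * V <= \int[P]_x expR (u x).
  rewrite -ler_ln ?posrE ?mulr_gt0 ?expR_gt0// lnM ?posrE ?expR_gt0// expRK.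
  by rewrite lerBlDl -lerBlDr addrC.
(* The left side is written as the integral of a pointwise minorant of [expR (u x)]; this uses that
   [expR (v x)] integrates to [V] and [phi] to [m - t]. *)
have -> : expR (- m) * V = \int[P]_x (expR (- m) * (1 + m - t) * expR (v x)
    - expR (- m) * V * phi x).
  rewrite RintegralB//; try exact: integrable_EFinZ.
  rewrite !RintegralZl// -VE (_ : Rintegral _ _ phi = m - t).
    by ring.
  by rewrite -mE /robust_obj addrC addKr.
apply: Rintegral_le => //.
  by apply: integrable_EFinB; exact: integrable_EFinZ.
move=> x.
have -> : expR (u x) = expR (- m) * (expR (v x) * expR (m - (v x - u x))).
  by rewrite -!expRD; congr expR; ring.
rewrite -!mulrA -mulrBr ler_pM2l ?expR_gt0//.
have le1 : expR (v x) * (1 + (m - (v x - u x))) <=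
    expR (v x) * expR (m - (v x - u x)).
  by rewrite ler_pM2l ?expR_gt0// expR_ge1Dx.
apply: le_trans le1.
(* The slope [expR (v x) / V] lies between the inverse of [h x] and [h x], so [stretch] dominates
   it. *)
suff : expR (v x) * (v x - u x - t) <= V * phi x by lra.
have -> : expR (v x) = V * (expR (v x) / V) by field; rewrite gt_eqF.
rewrite -mulrA ler_pM2l//; apply: le_stretch; apply/andP; split.
  by rewrite ler_pdivlMr// mulrC ler_pdivrMr ?h_gt0// mulrC.
by rewrite ler_pdivrMr// mulrC.
Qed.

(** A countable infimum is needed for measurability. Moving [t] up to a rational [q] raises the
    objective by at most [q - t], since its integral part is nonincreasing in [t]. *)
Lemma robust_rat f : admissible f ->
  robust f = inf (range (fun q : rat => robust_obj f (ratr q))).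
Proof.
move=> af; apply/eqP; rewrite eq_le; apply/andP; split.
  apply: lb_le_inf; first by exists (robust_obj f (ratr 0)), 0.
  by move=> _ [q _ <-]; exact: robust_le.
apply: le_robust => t; apply/ler_addgt0Pr => e e0.
have [|q] := @rat_in_itvoo R t (t + e); first by rewrite ltrDl.
rewrite in_itv/= => /andP[tq qte].
apply: (@le_trans _ _ (robust_obj f (ratr q))).
  apply: ge_inf; last by exists q.
  by exists (\int[P]_x f x) => _ [s _ <-]; exact: robust_obj_ge.
rewrite /robust_obj addrAC lerD ?(ltW qte)//.
apply: Rintegral_le; try exact: stretch_shift_integrable.
move=> x; have qt : f x - ratr q <= f x - t by rewrite lerD2l lerN2 ltW.
apply: le_trans (stretch_incr (h_ge1 x) qt).
by rewrite lerDl mulr_ge0 ?invr_ge0 ?subr_ge0// ltW.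
Qed.

End robust_expectation.

(** * Comparison of measures on a set, conditioning, and measurability of integrals *)

Section measures.
Context d (T : measurableType d) (R : realType).

Lemma ge0_le_integral_within (m1 m2 : {measure set T -> \bar R}) (C : set T)
    (k : R) (f : T -> \bar R) :
    measurable C -> 0 <= k ->
    (forall D, measurable D -> k%:E * m1 (D `&` C) <= m2 (D `&` C))%E ->
    (forall x, 0 <= f x)%E -> measurable_fun [set: T] f ->
  (k%:E * \int[m1]_(x in C) f x <= \int[m2]_(x in C) f x)%E.
Proof.
move=> mC k0 m12 f0 mf; have mCc := measurableC mC.
pose kn := NngNum k0.
(* [k m1 <= m2 + k m1(. `\` C)] on all sets, and the last measure vanishes on [C]. *)
pose n := measure_add m2 (mscale kn (mrestr m1 mCc)).
have le1 : (forall S, measurable S -> mscale kn m1 S <= n S)%E.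
  move=> S mS; rewrite /n measure_addE /mscale /= /mrestr.
  rewrite (_ : m1 S = m1 (S `&` C) + m1 (S `&` ~` C))%E; last first.
    rewrite -[in LHS](setIT S) -(setUv C) setIUr measureU//.
    - exact: measurableI.
    - exact: measurableI.
    - by rewrite setIACA setICr setI0.
  rewrite ge0_muleDr//; apply: leeD => //.
  apply: (le_trans (m12 _ mS)); apply: le_measure; rewrite ?inE//.
  exact: measurableI.
have mfC : measurable_fun C f by exact: measurable_funS mf.
have := ge0_le_measure_integral le1 mC f0 mf.
rewrite ge0_integral_mscale//= => /le_trans; apply.
rewrite ge0_integral_measure_add// [X in (_ + X)%E]null_set_integral ?adde0//.
by rewrite /= /mscale /= /mrestr setICr measure0 mule0.
Qed.

Lemma conditional_probability (P : probability T R) (C : set T) :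
  measurable C -> (0 < P C)%E ->
  exists m : probability T R,
    forall D, measurable D -> (P C * m D = P (D `&` C))%E.
Proof.
move=> mC PC0; exists (mnormalize (mrestr P mC) P) => D mD /=.
have PCfin : P C \is a fin_num by exact: fin_num_measure.
have PE : mrestr P mC [set: T] = P C by rewrite /mrestr setTI.
(* [mnormalize] falls back on a default when the total mass is zero or infinite; both cases are
   excluded by the bounds on [P C]. *)
rewrite /mnormalize; case: ifPn => [/orP[]/eqP H|_].
- by move: PC0; rewrite (etrans (esym PE) H) ltxx.
- by move: PCfin; rewrite (etrans (esym PE) H).
transitivity (P C * (P (D `&` C) * (fine (P C))^-1%:E))%E.
  by congr (_ * (_ * (fine _)^-1%:E))%E; exact: PE.
rewrite muleC -muleA -{2}(fineK PCfin) -EFinM mulVf ?mule1//.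
by rewrite fine_eq0// gt_eqF.
Qed.

End measures.

Lemma measurable_integral_probability (dX dY : measure_display)
    (X : measurableType dX) (Y : measurableType dY) (R : realType)
    (S : set X) (Q : X -> probability Y R) (f : Y -> \bar R) :
    measurable S -> (forall D, measurable D -> measurable_fun S (Q ^~ D)) ->
    (forall y, 0 <= f y)%E -> measurable_fun [set: Y] f ->
  measurable_fun S (fun x => \int[Q x]_y f y)%E.
Proof.
move=> mS mQ f0 mf.
(* Extension by the zero measure off [S] yields a kernel on the whole space that agrees with [Q] on
   [S]. *)
pose l x : {measure set Y -> \bar R} :=
  if x \in S as _ return {measure set Y -> \bar R} then Q x else mzero.
have ml U : measurable U -> measurable_fun [set: X] (l ^~ U).
  move=> mU; rewrite (_ : l ^~ U = (Q ^~ U) \_ S).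
    exact/(measurable_restrictT _ mS)/mQ.
  by apply/funext => x; rewrite /l patchE; case: ifPn.
have := measurable_fun_integral_kernel ml f0 mf.
move=> /(@measurable_funTS _ _ _ _ S); apply: eq_measurable_fun => x xS.
by rewrite /l xS.
Qed.

Lemma wspaceP (R : realType) (d : measure_display) (X : measurableType d)
    (w v : X -> R) : (forall x, 0 < w x) ->
  wspace w v <-> measurable_fun [set: X] v /\
    exists2 c, 0 <= c & forall x, `|v x| <= c * w x.
Proof.
move=> w0; split=> -[mv].
  move=> wv; split => //; have ub x : ((`|v x| / w x)%:E <= wnorm w v)%E.
    by apply: ereal_sup_ubound; exists x.
  (* [point] shows that the supremum is taken over a nonempty set, so it is not -oo. *)
  have c0 : (0 <= wnorm w v)%E.
    by apply: le_trans (ub point); rewrite lee_fin divr_ge0// ltW.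
  have cfin : wnorm w v \is a fin_num by rewrite ge0_fin_numE.
  exists (fine (wnorm w v)) => [|x]; first exact: fine_ge0.
  by rewrite -ler_pdivrMr// -lee_fin fineK.
move=> [c c0 vc]; split => //; apply: (@le_lt_trans _ _ c%:E); last exact: ltry.
by apply: ge_ereal_sup => _ [x _ <-]; rewrite lee_fin ler_pdivrMr.
Qed.

(** * Exponential moments of the weight [w0] *)

Section power_weight.
Context d (T : measurableType d) (R : realType).
Variables (w1 : T -> R) (p : R).
Hypotheses (mw1 : measurable_fun [set: T] w1) (w1_ge1 : forall x, 1 <= w1 x).
Hypothesis p01 : 0 < p < 1.
Implicit Types (v : T -> R) (a c : R).
Local Notation w0 := (fun x => w1 x `^ p).

Let w1_gt0 x : 0 < w1 x. Proof. exact: lt_le_trans (w1_ge1 x). Qed.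

Let p_le1 : 0 <= p <= 1. Proof. by case/andP: p01 => /ltW -> /ltW ->. Qed.

Lemma measurable_power : measurable_fun [set: T] w0.
Proof. exact: (measurableT_comp (measurable_powR p) mw1). Qed.

Lemma power_sublinear c : 0 <= c ->
  exists2 D, 0 <= D & forall x, c * w1 x `^ p <= w1 x + D.
Proof.
move=> c0; have [|D D0 h] := @powR_absorb R p 1 c 1 _ c0 ltr01.
  by case/andP : p01 => /ltW -> ->.
exists D => // x; have := h _ (w1_ge1 x).
by rewrite mul1r powRr1// ltW.
Qed.

Variable P : probability T R.
Local Notation intg f := (P.-integrable [set: T] (EFin \o f)).
Hypothesis Iw1 : intg (fun x => expR (w1 x)).

Lemma integrable_expR_affine a c : 0 <= c -> intg (fun x => expR (a + c * w1 x `^ p)).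
Proof.
move=> c0; have [D D0 Dle] := power_sublinear c0.
apply: (@integrable_dominated _ _ _ P _ (fun x => expR (a + D) * expR (w1 x))).
- apply: measurableT_comp => //; apply: measurable_funD => //.
  by apply: measurable_funM => //; exact: measurable_power.
- move=> x; rewrite ger0_norm ?expR_ge0// -expRD ler_expR -addrA lerD2l addrC.
  exact: Dle.
- exact: integrable_EFinZ.
Qed.

Lemma integrable_expR_power v c : measurable_fun [set: T] v -> 0 <= c ->
  (forall x, `|v x| <= c * (1 + w1 x `^ p)) -> intg (expR \o v).
Proof.
move=> mv c0 vc; apply: integrable_dominated (integrable_expR_affine c c0).
  exact: measurableT_comp.
move=> x /=; rewrite ger0_norm ?expR_ge0// ler_expR.
by rewrite (le_trans (ler_norm _))// (le_trans (vc x))// mulrDr mulr1.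
Qed.

(** Since c (1 + w0) is at most its exponential, multiplying the density bound by [v] only enlarges
    the coefficient of w0 in the exponent. *)
Lemma admissible_power a v c : measurable_fun [set: T] v -> 0 <= c ->
  (forall x, `|v x| <= c * (1 + w1 x `^ p)) ->
  admissible P (fun x => expR (a + w1 x `^ p)) v.
Proof.
move=> mv c0 vc; split => //.
have c10 : 0 <= 1 + c by rewrite addr_ge0.
apply: integrable_dominated (integrable_expR_affine (a + c) c10).
  apply: measurable_funM => //; apply: measurableT_comp => //.
  by apply: measurable_funD => //; exact: measurable_power.
move=> x /=; rewrite normrM ger0_norm ?expR_ge0//.
have -> : a + c + (1 + c) * w1 x `^ p = a + w1 x `^ p + c * (1 + w1 x `^ p).
  by ring.
rewrite [leRHS]expRD ler_pM2l ?expR_gt0// (le_trans (vc x))//.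
by apply: le_trans (expR_ge1Dx _); rewrite lerDr.
Qed.

Variable m : R.
Hypothesis Pw1 : \int[P]_x expR (w1 x) <= expR m.

(** This keeps the tangent slope p m^(p - 1) of the power at [m] within [0, 1], as the chord bound
    requires. *)
Lemma drift_ge1 : 1 <= m.
Proof.
rewrite -ler_expR; apply: le_trans Pw1; rewrite -[leLHS](Rintegral_prob_cst P).
apply: Rintegral_le => //; first exact: integrable_EFin_cst.
by move=> x; rewrite ler_expR.
Qed.

(* Concavity of the power and convexity of the exponential combine into
   [expR (s `^ p - m `^ p) <= 1 + theta (expR (s - m) - 1)]. *)
Lemma Rintegral_expR_power : \int[P]_x expR (w1 x `^ p) <= expR (m `^ p).
Proof.
have m1 := drift_ge1; have m0 : 0 < m by apply: lt_le_trans m1.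
have [theta thE th01] : exists2 theta, p * m `^ (p - 1) = theta & 0 <= theta <= 1.
  case/andP: p_le1 => p0 p1; exists (p * m `^ (p - 1)) => //.
  rewrite mulr_ge0 ?powR_ge0//=.
  rewrite mulr_ile1// ?powR_ge0// -[leRHS](powRr0 m) ler_powR// lerBlDr add0r.
  by case/andP : p01 => _ /ltW.
have -> : expR (m `^ p) = expR (m `^ p) * (1 - theta) + expR (m `^ p) * theta.
  by ring.
apply: (@le_trans _ _ (\int[P]_x (expR (m `^ p) * (1 - theta) +
    expR (m `^ p) * theta * expR (- m) * expR (w1 x)))).
  apply: Rintegral_le.
  - by have := @integrable_expR_affine 0 1 ler01;
      under eq_fun do rewrite add0r mul1r.
  - by apply: integrable_EFinD; [exact: integrable_EFin_cst|exact: integrable_EFinZ].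
  move=> x; rewrite -!mulrA -mulrDr.
  rewrite (_ : w1 x `^ p = m `^ p + (w1 x `^ p - m `^ p)); last by ring.
  rewrite expRD ler_pM2l ?expR_gt0//.
  have := powR_le_tangent p_le1 m0 (w1_gt0 x).
  rewrite -lerBlDl thE -ler_expR => /le_trans; apply.
  apply: (le_trans (expR_le_chord _ th01)).
  by rewrite -expRD (addrC (- m)) le_eqVlt; apply/orP; left; apply/eqP; ring.
(* The factor [expR (- m)] cancels the moment bound [Pw1], so the two terms recombine with weights
   [1 - theta] and [theta]. *)
rewrite RintegralD//; [|exact: integrable_EFin_cst|exact: integrable_EFinZ].
rewrite Rintegral_prob_cst RintegralZl// lerD2l -[leRHS]mulr1 -!mulrA.
case/andP : th01 => th0 _; rewrite !ler_wpM2l ?expR_ge0//.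
by rewrite expRN mulrC ler_pdivrMr ?expR_gt0// mul1r.
Qed.

(** Jensen is used twice: for -w0, and for w0 together with [Rintegral_expR_power] to see that the
    mean of w0 is at most m^p. *)
Lemma Rintegral_expRN_power : expR (- m `^ p) <= \int[P]_x expR (- w1 x `^ p).
Proof.
have w00 x : 0 <= w1 x `^ p by exact: powR_ge0.
have Iew : intg (expR \o w0).
  by have := @integrable_expR_affine 0 1 ler01;
    under eq_fun do rewrite add0r mul1r.
have Iw : intg w0.
  apply: integrable_dominated Iew; first exact: measurable_power.
  move=> x; rewrite ger0_norm//; apply: le_trans (expR_ge1Dx _).
  by rewrite lerDr.
have INw : intg (fun x => - w1 x `^ p).
  by have := integrable_EFinZ (-1) Iw; under eq_fun do rewrite mulN1r.
have INew : intg (expR \o (fun x => - w1 x `^ p)).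
  apply: integrable_dominated Iew.
    by apply: measurableT_comp => //; exact: (measurable_integrable INw).
  by move=> x /=; rewrite ger0_norm ?expR_ge0// ler_expR (le_trans _ (w00 x))// oppr_le0.
apply: le_trans (jensen_expR INw INew); rewrite ler_expR.
have -> : \int[P]_x (- w1 x `^ p) = - \int[P]_x (w1 x `^ p).
  rewrite -mulN1r -RintegralZl//.
  by apply: eq_Rintegral => x _; rewrite mulN1r.
rewrite lerN2 -ler_expR.
exact: le_trans (jensen_expR Iw Iew) Rintegral_expR_power.
Qed.

End power_weight.

(** * Integrals restricted to a set *)

Section restricted_integrals.
Context d (T : measurableType d) (R : realType).
Implicit Types (P : probability T R) (f : T -> R).

Lemma integrable_patch P f (C : set T) : measurable C ->
  P.-integrable [set: T] (EFin \o f) ->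
  P.-integrable [set: T] (EFin \o (f \_ C)).
Proof.
move=> mC If; apply: integrable_dominated (integrable_EFin_norm If).
  apply/(measurable_restrictT _ mC)/measurable_funTS.
  exact: measurable_integrable If.
by move=> x; rewrite patchE; case: ifPn => // _; rewrite normr0.
Qed.

Lemma integral_patch P f (C : set T) : measurable C ->
  P.-integrable [set: T] (EFin \o f) ->
  (\int[P]_(x in C) (f x)%:E = (\int[P]_x (f \_ C) x)%:E)%E.
Proof.
move=> mC If; rewrite -EFin_Rintegral; last exact: integrable_patch.
by rewrite integral_mkcond; apply: eq_integral => x _; rewrite restrict_EFin.
Qed.

Lemma Rintegral_le_within (P1 P2 : probability T R) (C : set T) (k : R) f :
    measurable C -> 0 <= k ->
    (forall D, measurable D -> k%:E * P1 (D `&` C) <= P2 (D `&` C))%E ->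
    (forall x, 0 <= f x) ->
    P1.-integrable [set: T] (EFin \o f) -> P2.-integrable [set: T] (EFin \o f) ->
  k * \int[P1]_x (f \_ C) x <= \int[P2]_x (f \_ C) x.
Proof.
move=> mC k0 P12 f0 I1 I2.
have mf := measurable_integrable I1.
have := @ge0_le_integral_within _ _ _ P1 P2 C k (EFin \o f) mC k0 P12.
rewrite !integral_patch// -EFinM lee_fin; apply; last exact/measurable_EFinP.
by move=> x; rewrite lee_fin.
Qed.

End restricted_integrals.

Lemma ln_le_expR (R : realType) (a b : R) : 0 < a -> a <= expR b -> ln a <= b.
Proof. by move=> a0 ab; rewrite -[leRHS]expRK ler_ln ?posrE ?expR_gt0. Qed.

Lemma expR_le_ln (R : realType) (a b : R) : expR a <= b -> a <= ln b.
Proof.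
move=> ab; rewrite -[leLHS]expRK ler_ln ?posrE ?expR_gt0//.
exact: lt_le_trans (expR_gt0 _) ab.
Qed.

(** Each summand is at most half of the right side, by [1 + 2 * k <= expR (2 * k)] and
    [2 <= expR 1]. *)
Lemma le_expR_double (R : realType) (k : R) : k + expR (2 * k - 1) <= expR (2 * k).
Proof.
have e1 : 2 <= expR 1 :> R := expR_ge1Dx 1.
have e2 := expR_ge1Dx (2 * k).
have e3 : expR (2 * k - 1) * 2 <= expR (2 * k).
  by rewrite -[X in _ <= expR X](subrK 1) [leRHS]expRD ler_pM2l ?expR_gt0.
lra.
Qed.

(** * The entropic map under the drift condition: (A1) and (A2) *)

Section entropic_control.
Context (R : realType) (dX dA : measure_display).
Context (X : measurableType dX) (A : measurableType dA).
Variables (M : markov_control_process R X A) (w1 : X -> R) (gamma1 K1 p : R).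
Hypotheses (w1_meas : measurable_fun [set: X] w1) (w1_ge1 : forall x, 1 <= w1 x).
Hypotheses (gamma1_01 : 0 < gamma1 < 1) (K1_gt0 : 0 < K1).
Hypothesis drift : forall x a, feasible M x a ->
  (entropic M (x, a) w1 <= (gamma1 * w1 x + K1)%:E)%E.
Hypothesis p01 : 0 < p < 1.
Implicit Types (v u : X -> R) (c q r C : R).

Local Notation Q := (transition M).
Local Notation w0 := (fun x => w1 x `^ p).
Local Notation drift0 x := ((gamma1 * w1 x + K1) `^ p).

Let gamma1_gt0 : 0 < gamma1. Proof. by case/andP : gamma1_01. Qed.
Let p_gt0 : 0 < p. Proof. by case/andP : p01. Qed.
Let w1_gt0 x : 0 < w1 x. Proof. exact: lt_le_trans (w1_ge1 x). Qed.
Let w0_ge0 x : 0 <= w1 x `^ p. Proof. exact: powR_ge0. Qed.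

Let driftP x a : feasible M x a ->
  (\int[Q (x, a)]_y (expR (w1 y))%:E <= (expR (gamma1 * w1 x + K1))%:E)%E.
Proof.
move=> /drift; rewrite /entropic; case: (integral _ _ _) => [r| |] /=;
  [|by rewrite leye_eq|by rewrite !leNye].
(* For [r <= 0] the logarithm carries no information, but the bound is trivial. *)
have [r0 _|r0] := leP r 0; first by rewrite lee_fin (le_trans r0)// expR_ge0.
by rewrite !lee_fin -ler_expR lnK ?posrE.
Qed.

Lemma drift_integrable x a : feasible M x a ->
  (Q (x, a)).-integrable [set: X] (EFin \o (fun y => expR (w1 y))).
Proof.
move=> /driftP fxa; apply/integrableP; split.
  by apply/measurable_EFinP; exact: measurableT_comp.
apply: le_lt_trans (ltry (expR (gamma1 * w1 x + K1))); apply: le_trans fxa.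
apply: ge0_le_integral => //.
- by apply: measurableT_comp => //; apply/measurable_EFinP; exact: measurableT_comp.
- by apply/measurable_EFinP; exact: measurableT_comp.
- by move=> y _ /=; rewrite ger0_norm ?expR_ge0.
Qed.

Lemma drift_Rintegral x a : feasible M x a ->
  \int[Q (x, a)]_y expR (w1 y) <= expR (gamma1 * w1 x + K1).
Proof.
move=> fxa; rewrite -lee_fin -EFin_Rintegral; first exact: driftP.
exact: drift_integrable.
Qed.

(** On functions of growth w0 the extended-real map is finite, which reduces later comparisons to
    real logarithms. *)
Lemma entropicE x a v c : feasible M x a -> measurable_fun [set: X] v ->
    0 <= c -> (forall y, `|v y| <= c * (1 + w1 y `^ p)) ->
  0 < \int[Q (x, a)]_y expR (v y) /\
  entropic M (x, a) v = (ln (\int[Q (x, a)]_y expR (v y)))%:E.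
Proof.
move=> fxa mv c0 vc.
have Iw1 := drift_integrable fxa.
have Iev := integrable_expR_power w1_meas w1_ge1 p01 Iw1 mv c0 vc.
have av := admissible_power w1_meas w1_ge1 p01 Iw1 0 mv c0 vc.
have Iv : (Q (x, a)).-integrable [set: X] (EFin \o v).
  apply: admissible_integrable av => y.
  by rewrite -expR0 ler_expR add0r.
have I0 := Rintegral_expR_gt0 Iv Iev.
by split => //; rewrite /entropic EFin_Rintegral// lne_EFin.
Qed.

Lemma drift0_le x : drift0 x <= gamma1 `^ p * w1 x `^ p + K1 `^ p.
Proof.
rewrite -powRM ?(ltW gamma1_gt0) ?(ltW (w1_gt0 x))//.
by rewrite powR_subadditive ?mulr_gt0//; case/andP : p01 => /ltW -> /ltW ->.
Qed.

Lemma drift0_mono x s : w1 x <= s -> drift0 x <= (gamma1 * s + K1) `^ p.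
Proof.
move=> xs; have p0 := ltW p_gt0; have g0 := ltW gamma1_gt0; have k0 := ltW K1_gt0.
have s0 : 0 <= s by exact: le_trans (ltW (w1_gt0 x)) xs.
by rewrite ge0_ler_powR ?nnegrE ?addr_ge0 ?mulr_ge0 ?(ltW (w1_gt0 x))// lerD2r ler_wpM2l.
Qed.

Let w0_bound y : `|w1 y `^ p| <= 1 * (1 + w1 y `^ p).
Proof. by rewrite ger0_norm// mul1r lerDr. Qed.

Let Nw0_bound y : `|- w1 y `^ p| <= 1 * (1 + w1 y `^ p).
Proof. by rewrite normrN. Qed.

Let mw0 : measurable_fun [set: X] w0.
Proof. exact: measurable_power. Qed.

Let mNw0 : measurable_fun [set: X] (fun y => - w1 y `^ p).
Proof. exact: measurable_funN. Qed.

Lemma entropic_drift q C : 0 <= q < p -> 0 <= C ->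
    (forall x a, feasible M x a -> `|cost M (x, a)| <= C * w1 x `^ q) ->
  exists gamma0 K0 : R, [/\ 0 < gamma0 < 1, 0 < K0 &
    forall x a, feasible M x a ->
      (Order.max ((cost M (x, a))%:E + entropic M (x, a) w0)
         (- ((cost M (x, a))%:E + entropic M (x, a) (fun z => - w1 z `^ p)%R))
       <= (gamma0 * w1 x `^ p + K0)%:E)%E].
Proof.
move=> qp C0 hc.
have [g gE /andP[g0 g1]] : exists2 g, gamma1 `^ p = g & 0 < g < 1.
  exists (gamma1 `^ p) => //; rewrite powR_gt0//=.
  case/andP : gamma1_01 => _ g1; have <- : 1 `^ p = 1 :> R by rewrite powR1.
  by rewrite gt0_ltr_powR ?nnegrE// ltW.
(* Half of the gap [1 - g] is spent on absorbing the cost, which grows with the smaller exponent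
   [q]. *)
have [|D D0 hD] := @powR_absorb R q p C ((1 - g) / 2) qp C0; first lra.
have k0 : 0 < K1 `^ p by rewrite powR_gt0.
exists (g + (1 - g) / 2), (K1 `^ p + D); split; try lra.
move=> x a fxa.
have Iw1 := drift_integrable fxa; have Pw1 := drift_Rintegral fxa.
have [I0 ->] := entropicE fxa mw0 ler01 w0_bound.
have [J0 ->] := entropicE fxa mNw0 ler01 Nw0_bound.
have cb := le_trans (hc _ _ fxa) (hD _ (w1_ge1 x)).
have := drift0_le x; rewrite gE => hE.
have lI : ln (\int[Q (x, a)]_y expR (w1 y `^ p)) <= drift0 x.
  apply: ln_le_expR => //.
  exact: Rintegral_expR_power.
have lJ : - drift0 x <= ln (\int[Q (x, a)]_y expR (- w1 y `^ p)).
  apply: expR_le_ln.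
  exact: Rintegral_expRN_power.
have c1 := ler_norm (cost M (x, a)).
have c2 : - cost M (x, a) <= `|cost M (x, a)| by rewrite -normrN ler_norm.
rewrite ge_max -!EFinD -EFinN !lee_fin.
move: lI; move: (ln (Rintegral _ _ (fun y => expR (w1 y `^ p)))) => i lI.
move: lJ; move: (ln (Rintegral _ _ _)) => j lJ.
move: cb c1 c2 hE lI lJ; move: (cost M (x, a)) `|_| (w1 x `^ p) (drift0 x) (K1 `^ p).
by move=> *; apply/andP; split; lra.
Qed.

(** On the level set all kernels lie between [lm] and [lp] times the same measure, hence dominate
    each other up to the factor [lm / lp]. *)
Lemma doeblin_ratio r : local_doeblin M w1 -> (exists x, w1 x <= r) ->
  exists2 k : R, 0 < k &
    (forall x y a b (D : set X), w1 x <= r -> w1 y <= r ->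
       feasible M x a -> feasible M y b -> measurable D ->
       (k%:E * Q (x, a) (D `&` [set z | w1 z <= r]%R) <=
        Q (y, b) (D `&` [set z | w1 z <= r]%R))%E) /\
    (forall x a, w1 x <= r -> feasible M x a ->
       (0 < Q (x, a) [set z | w1 z <= r]%R)%E).
Proof.
move=> doeblin [x0 x0r]; have r0 : 0 < r by apply: lt_le_trans x0r.
have [|mu [lp [lm [lp0 lm0 muC h]]]] := doeblin r r0; first by exists x0.
exists (lm / lp); first by rewrite divr_gt0.
split=> [x y a b D xr yr fx fy mD|x a xr fx].
  have [_ h1] := h x a D xr fx mD; have [h2 _] := h y b D yr fy mD.
  apply: le_trans h2; rewrite -(@lee_pmul2l _ lp%:E)// muleA -EFinM.
  rewrite mulrCA divff ?gt_eqF// mulr1 muleCA lee_pmul2l//.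
have [h1 _] := h x a setT xr fx measurableT.
by rewrite setTI in h1; apply: lt_le_trans h1; rewrite mule_gt0.
Qed.

Lemma level_measurable r : measurable [set z | w1 z <= r].
Proof.
rewrite -[X in measurable X]setTI.
rewrite (_ : [set z | w1 z <= r] = w1 @^-1` `]-oo, r]%classic).
  by apply: w1_meas => //; exact: measurable_itv.
by apply/seteqP; split=> z /=; rewrite in_itv.
Qed.

Lemma power_level x r : 0 <= r -> w1 x `^ p <= r -> w1 x <= r `^ p^-1.
Proof.
move=> r0 xr; rewrite -[leLHS]powRr1 ?(ltW (w1_gt0 x))//.
rewrite -(@divff _ p) ?gt_eqF// powRrM.
by rewrite ge0_ler_powR ?nnegrE// invr_ge0 ltW.
Qed.

(* Off a large level set [expR (w0)] is negligible against [expR w1], whatever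
   [K]; on the level set the two kernels are comparable up to a factor which is
   then beaten by [expR (2 K)]. *)
Lemma entropic_minorization gamma0 K0 : local_doeblin M w1 ->
    0 < gamma0 < 1 -> 0 < K0 ->
  exists2 K, K0 < K & forall v x y a b,
    wspace (fun z => 1 + w1 z `^ p) v -> (forall z, `|v z| <= w1 z `^ p + K) ->
    w1 x `^ p <= 2 * K0 / (1 - gamma0) -> w1 y `^ p <= 2 * K0 / (1 - gamma0) ->
    feasible M x a -> feasible M y b ->
    ((2 * K0)%:E <=
       entropic M (x, a) (fun z => w1 z `^ p + K)%R - entropic M (x, a) v
       + entropic M (y, b) v - entropic M (y, b) (fun z => - w1 z `^ p - K)%R)%E.
Proof.
move=> doeblin /andP[g0 g1] K00.
have r0 : 0 <= 2 * K0 / (1 - gamma0) by rewrite divr_ge0// ?subr_ge0; lra.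
move: r0; move: (2 * K0 / (1 - gamma0)) => r r0.
move SE : (r `^ p^-1) => S0.
move BE : (gamma1 * S0 + K1) => B.
move EE : (B `^ p) => EB.
have [D D0 Dle] := power_sublinear w1_ge1 p01 (ler0n R 2).
(* Chosen so that the tail bound [expR (K - N + B)] below equals [expR (2 * ki - 1)] times
   [expR (- K - EB)], the lower bound for the integral at [(y, b)]. *)
pose N := B + 2 * K0 + EB + 1.
(* [S0] puts [x] and [y] in the level set, [w1 point] makes it nonempty, and beyond [D + 2 * N] one
   has w0 <= w1 - N. *)
pose L := Num.max S0 (Num.max (w1 point) (D + 2 * N)).
have [|k k0 [kQ _]] := @doeblin_ratio L doeblin.
  by exists point; rewrite !le_max lexx orbT.
have ki0 : 0 < k^-1 by rewrite invr_gt0.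
move kE : (k^-1) => ki; rewrite kE in ki0.
(* The level [L], and with it [k], does not depend on [K], so [K] may be chosen in terms of [k]. *)
exists (K0 + ki); first by rewrite ltrDl.
move KE : (K0 + ki) => K.
move=> v x y a b [mv _] vK xr yr fx fy.
have xS := power_level r0 xr; have yS := power_level r0 yr; rewrite SE in xS yS.
have xL : w1 x <= L by rewrite !le_max xS.
have yL : w1 y <= L by rewrite !le_max yS.
pose C := [set z | w1 z <= L]; have mC : measurable C by exact: level_measurable.
have K_ge0 : 0 <= K by lra.
have bd u : (forall z, `|u z| <= w1 z `^ p + K) ->
    forall z, `|u z| <= (1 + K) * (1 + w1 z `^ p).
  move=> uK z; apply: (le_trans (uK z)).
  have := mulr_ge0 K_ge0 (w0_ge0 z); lra.
have K10 : 0 <= 1 + K by lra.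
have vb := bd _ vK.
have ub : forall z, `|w1 z `^ p + K| <= (1 + K) * (1 + w1 z `^ p).
  by apply: (bd (fun z => w1 z `^ p + K)) => z; rewrite ger0_norm// addr_ge0.
have lb : forall z, `|- w1 z `^ p - K| <= (1 + K) * (1 + w1 z `^ p).
  by move=> z; rewrite -opprD normrN.
have mu : measurable_fun [set: X] (fun z => w1 z `^ p + K) by exact: measurable_funD.
have ml : measurable_fun [set: X] (fun z => - w1 z `^ p - K).
  exact: measurable_funB.
have Ix := drift_integrable fx; have Iy := drift_integrable fy.
have Iex v' := @integrable_expR_power _ _ _ _ _ w1_meas w1_ge1 p01 _ Ix v' _.
have Iey v' := @integrable_expR_power _ _ _ _ _ w1_meas w1_ge1 p01 _ Iy v' _.
have [u0 ->] := entropicE fx mu K10 ub.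
have [vx0 ->] := entropicE fx mv K10 vb.
have [vy0 ->] := entropicE fy mv K10 vb.
have [l0 ->] := entropicE fy ml K10 lb.
rewrite -!EFinN -!EFinD lee_fin.
(* The two outer terms contribute [K] each, which leaves [2 * K - 2 * K0 = 2 * ki] for the
   difference of the logarithms of the integrals of [expR (v z)]. *)
have hu : K <= ln (\int[Q (x, a)]_z expR (w1 z `^ p + K)).
  apply: expR_le_ln.
  rewrite -[leLHS](Rintegral_prob_cst (Q (x, a))); apply: Rintegral_le.
  - exact: integrable_EFin_cst.
  - exact: Iex _ _ mu K10 ub.
  - by move=> z; rewrite ler_expR lerDr.
have hl : ln (\int[Q (y, b)]_z expR (- w1 z `^ p - K)) <= - K.
  apply: ln_le_expR => //.
  rewrite -[leRHS](Rintegral_prob_cst (Q (y, b))); apply: Rintegral_le.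
  - exact: Iey _ _ ml K10 lb.
  - exact: integrable_EFin_cst.
  - by move=> z; rewrite ler_expR gerDr oppr_le0.
(* This lower bound allows the constant tail at [(x, a)] to be charged to the integral at
   [(y, b)]. *)
have hIy : expR (- K - EB) <= \int[Q (y, b)]_z expR (v z).
  have Nw0I := Iey _ _ mNw0 ler01 Nw0_bound.
  apply: (@le_trans _ _ (\int[Q (y, b)]_z (expR (- K) * expR (- w1 z `^ p)))).
    rewrite RintegralZl// expRD ler_pM2l ?expR_gt0//.
    apply: le_trans (Rintegral_expRN_power w1_meas w1_ge1 p01 Iy (drift_Rintegral fy)).
    by rewrite ler_expR lerN2 -EE -BE drift0_mono.
  apply: Rintegral_le; [exact: integrable_EFinZ|exact: Iey _ _ mv K10 vb|move=> z].
  rewrite -expRD ler_expR.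
  by have := vK z; rewrite ler_norml => /andP[]; lra.
have Ivx := Iex _ _ mv K10 vb; have Ivy := Iey _ _ mv K10 vb.
have hIx : \int[Q (x, a)]_z expR (v z) <=
    \int[Q (x, a)]_z (((expR \o v) \_ C) z) + expR (K - N + B).
  apply: (@le_trans _ _ (\int[Q (x, a)]_z
      (((expR \o v) \_ C) z + expR (K - N) * expR (w1 z)))).
    apply: Rintegral_le => //.
      by apply: integrable_EFinD; [exact: integrable_patch|exact: integrable_EFinZ].
    move=> z; rewrite patchE; case: ifPn => [_|].
      by rewrite /= lerDl mulr_ge0 ?expR_ge0.
    rewrite notin_setE /C /= => /negP; rewrite -ltNge => Lz.
    rewrite add0r -expRD ler_expR.
    have : D + 2 * N < w1 z by apply: le_lt_trans Lz; rewrite !le_max lexx !orbT.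
    have := Dle z; have := le_trans (ler_norm _) (vK z); lra.
  rewrite RintegralD//; [|exact: integrable_patch|exact: integrable_EFinZ].
  rewrite lerD2l RintegralZl// [leRHS]expRD ler_pM2l ?expR_gt0//.
  apply: (le_trans (drift_Rintegral fx)).
  by rewrite ler_expR -BE lerD2r ler_pM2l.
have hC : \int[Q (x, a)]_z (((expR \o v) \_ C) z) <= ki * \int[Q (y, b)]_z expR (v z).
  rewrite -kE ler_pdivlMl//.
  apply: (@le_trans _ _ (\int[Q (y, b)]_z (((expR \o v) \_ C) z))).
    apply: Rintegral_le_within => //; first exact: ltW.
      by move=> E mE; exact: kQ.
    by move=> z; rewrite /= expR_ge0.
  apply: Rintegral_le => //; first exact: integrable_patch.
  by move=> z; rewrite patchE; case: ifPn => // _; rewrite expR_ge0.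
move: (ln (Rintegral (Q (x, a)) _ (fun z => expR (w1 z `^ p + K)))) hu => i hu.
move: (ln (Rintegral (Q (y, b)) _ (fun z => expR (- w1 z `^ p - K)))) hl => j hl.
suff : \int[Q (x, a)]_z expR (v z) <= expR (2 * ki) * \int[Q (y, b)]_z expR (v z).
  rewrite -ler_ln ?posrE ?mulr_gt0 ?expR_gt0// lnM ?posrE ?expR_gt0// expRK.
  move: (ln _) (ln _) => *; lra.
apply: (le_trans hIx).
have -> : K - N + B = (2 * ki - 1) + (- K - EB).
  rewrite /N -KE; ring.
have e4 : expR (2 * ki - 1 + (- K - EB)) <=
    expR (2 * ki - 1) * \int[Q (y, b)]_z expR (v z).
  by rewrite expRD ler_pM2l ?expR_gt0.
apply: (le_trans (lerD hC e4)); rewrite -mulrDl ler_pM2r//.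
exact: le_expR_double.
Qed.

End entropic_control.

(** * The upper envelope of the entropic map *)

Section upper_envelope.
Context (R : realType) (dX dA : measure_display).
Context (X : measurableType dX) (A : measurableType dA).
Variables (M : markov_control_process R X A) (w1 : X -> R) (gamma1 K1 p K : R).
Hypotheses (w1_meas : measurable_fun [set: X] w1) (w1_ge1 : forall x, 1 <= w1 x).
Hypothesis drift : forall x a, feasible M x a ->
  (entropic M (x, a) w1 <= (gamma1 * w1 x + K1)%:E)%E.
Hypotheses (p01 : 0 < p < 1) (K_gt0 : 0 < K).
Implicit Types (v u : X -> R) (c r k : R).

Local Notation Q := (transition M).
Local Notation KK := (feasible_pairs (feasible M)).
Local Notation w0 := (fun x => w1 x `^ p).
Local Notation drift0 x := ((gamma1 * w1 x + K1) `^ p).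

(* For [v] of [w]-seminorm at most [K], the density [expR v / \int expR v] lies
   between the inverse of this bound and the bound itself. *)
Definition density_bound (x y : X) : R := expR (2 * K + drift0 x + w1 y `^ p).

Definition entropic_envelope (xa : X * A) v : R :=
  robust (Q xa) (density_bound xa.1) v.

Let w0_ge0 x : 0 <= w1 x `^ p. Proof. exact: powR_ge0. Qed.

Let mw0 : measurable_fun [set: X] w0.
Proof. exact: measurable_power. Qed.

Lemma density_bound_ge1 x y : 1 <= density_bound x y.
Proof.
rewrite -expR0 ler_expR !addr_ge0 ?powR_ge0//.
by rewrite mulr_ge0// ltW.
Qed.

Lemma measurable_density_bound x : measurable_fun [set: X] (density_bound x).
Proof. by apply: measurableT_comp => //; exact: measurable_funD. Qed.

#[local] Hint Resolve density_bound_ge1 measurable_density_bound : core.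

Lemma integrable_density_bound x a : feasible M x a ->
  (Q (x, a)).-integrable [set: X] (EFin \o density_bound x).
Proof.
move=> /(drift_integrable w1_meas drift) Iw1.
have := integrable_expR_affine w1_meas w1_ge1 p01 Iw1 (2 * K + drift0 x) ler01.
by under eq_fun do rewrite mul1r.
Qed.

Lemma wspace_growth k v : 0 <= k -> wspace (fun x => 1 + k * w1 x `^ p) v ->
  measurable_fun [set: X] v /\
  exists2 c, 0 <= c & forall y, `|v y| <= c * (1 + w1 y `^ p).
Proof.
move=> k0 /wspaceP[] => [x|mv [c c0 vc]].
  by rewrite ltr_pwDl// mulr_ge0.
split=> //; exists (c * (1 + k)) => [|y]; first by rewrite mulr_ge0// addr_ge0.
apply: (le_trans (vc y)); rewrite -mulrA ler_wpM2l//.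
have := mulr_ge0 k0 (w0_ge0 y); have := w0_ge0 y; lra.
Qed.

Lemma wspace_admissible x a k v : feasible M x a -> 0 <= k ->
  wspace (fun x => 1 + k * w1 x `^ p) v ->
  admissible (Q (x, a)) (density_bound x) v.
Proof.
move=> fx k0 /(wspace_growth k0)[mv [c c0 vc]].
have Iw1 := drift_integrable w1_meas drift fx.
exact: (admissible_power w1_meas w1_ge1 p01 Iw1 _ mv c0 vc).
Qed.

(** The density bound factors into a function of [x] and a function of [y]. Splitting [stretch] into
    positive and negative parts therefore separates the variables, leaving integrals of the fixed
    functions [fp] and [fm]. *)
Lemma measurable_robust_obj k v t : 0 <= k ->
  wspace (fun x => 1 + k * w1 x `^ p) v ->
  measurable_fun KK (fun xa => robust_obj (Q xa) (density_bound xa.1) v t).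
Proof.
move=> k0 vw; have [mv _] := wspace_growth k0 vw.
pose fp y := expR (w1 y `^ p) * Num.max (v y - t) 0.
pose fm y := expR (- w1 y `^ p) * Num.max (- (v y - t)) 0.
have mvt : measurable_fun [set: X] (fun y => v y - t) by exact: measurable_funB.
have mfp : measurable_fun [set: X] fp.
  by apply: measurable_funM; [exact: measurableT_comp|exact: measurable_maxr].
have mfm : measurable_fun [set: X] fm.
  apply: measurable_funM; last by apply: measurable_maxr => //; exact: measurable_funN.
  by apply: measurableT_comp => //; exact: measurable_funN.
have fp0 y : 0 <= fp y by rewrite mulr_ge0 ?expR_ge0// le_max lexx orbT.
have fm0 y : 0 <= fm y by rewrite mulr_ge0 ?expR_ge0// le_max lexx orbT.
have mI (f : X -> R) : (forall y, 0 <= f y) -> measurable_fun [set: X] f ->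
    measurable_fun KK (fun xa => \int[Q xa]_y f y).
  move=> f0 mf; apply: (measurableT_comp (fine_measurable measurableT)).
  apply: measurable_integral_probability.
  - exact: feasible_pairs_measurable.
  - exact: transition_measurable.
  - by move=> y; rewrite lee_fin.
  - exact/measurable_EFinP.
pose H (xa : X * A) := 2 * K + drift0 xa.1.
have mH : measurable_fun KK H.
  apply: measurable_funTS; apply: measurable_funD => //.
  apply: (measurableT_comp (measurable_powR p)).
  apply: measurable_funD => //; apply: measurable_funM => //.
  exact: measurableT_comp.
apply: (@eq_measurable_fun _ _ _ _ _ (fun xa =>
  t + (expR (H xa) * \int[Q xa]_y fp y - expR (- H xa) * \int[Q xa]_y fm y))).
  move=> [x a]; rewrite inE => fx.
  have avt : admissible (Q (x, a)) (density_bound x) (fun y => v y - t).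
    apply: admissibleB; first exact: wspace_admissible fx k0 vw.
    by apply: admissible_cst; exact: integrable_density_bound.
  rewrite /robust_obj; congr (t + _).
  have Iv : (Q (x, a)).-integrable [set: X] (EFin \o (fun y => v y - t)).
    by apply: admissible_integrable avt; exact: density_bound_ge1.
  have Ifp : (Q (x, a)).-integrable [set: X] (EFin \o fp).
    have [_ Ih] := avt; apply: integrable_dominated (integrable_EFin_norm Ih) => //.
    move=> y; rewrite ger0_norm// normrM ger0_norm ?expR_ge0//.
    apply: ler_pM => //; rewrite ?expR_ge0//; first by rewrite le_max lexx orbT.
      rewrite ler_expR lerDr addr_ge0 ?powR_ge0//; by rewrite mulr_ge0// ltW.
    by rewrite ge_max ler_norm normr_ge0.
  have Ifm : (Q (x, a)).-integrable [set: X] (EFin \o fm).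
    apply: integrable_dominated (integrable_EFin_norm Iv) => //.
    move=> y; rewrite ger0_norm// -[leRHS]mul1r.
    apply: ler_pM; rewrite ?expR_ge0// ?le_max ?lexx ?orbT//.
    + by rewrite -expR0 ler_expR oppr_le0.
    + by rewrite ge_max -normrN ler_norm normr_ge0.
  rewrite -!RintegralZl// -RintegralB//; try exact: integrable_EFinZ.
  apply: eq_Rintegral => y _; rewrite stretchE//.
  by rewrite /fp /fm !mulrA -!expRD -opprD expRN.
apply: measurable_funD => //; apply: measurable_funB; apply: measurable_funM.
- exact: measurableT_comp.
- exact: mI.
- by apply: measurableT_comp => //; exact: measurable_funN.
- exact: mI.
Qed.

Lemma measurable_entropic_envelope k v : 0 <= k ->
  wspace (fun x => 1 + k * w1 x `^ p) v ->
  measurable_fun KK (fun xa => entropic_envelope xa v).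
Proof.
move=> k0 vw.
(* An enumeration of the rationals; codes that decode to nothing give 0, which is in the range
   anyway. *)
pose q n : R := ratr (odflt 0 (@unpickle rat n)).
pose J n (xa : X * A) := robust_obj (Q xa) (density_bound xa.1) v (q n).
have adm x a (fx : feasible M x a) := wspace_admissible fx k0 vw.
apply: (@eq_measurable_fun _ _ _ _ _ (fun xa => infs (J ^~ xa) 0)).
  move=> [x a]; rewrite inE => fx; rewrite /entropic_envelope robust_rat//.
  - rewrite /infs /=; congr inf; apply/seteqP; split=> [_ [n _ <-]|_ [s _ <-]] /=.
      by exists (odflt 0 (unpickle n)).
    by exists (pickle s) => //; rewrite /J /q pickleK.
  - exact: integrable_density_bound.
  - exact: adm.
apply: measurable_fun_infs => [[x a] fx|n].
  exists (\int[Q (x, a)]_y v y) => _ [n _ <-]; apply: robust_obj_ge => //.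
  - exact: integrable_density_bound.
  - exact: adm.
exact: measurable_robust_obj vw.
Qed.

Lemma entropic_envelope_coherent k : 0 <= k ->
  coherent_risk_map M (fun x => 1 + k * w1 x `^ p) entropic_envelope.
Proof.
move=> k0.
have adm x a v (fx : feasible M x a) := @wspace_admissible _ _ _ v fx k0.
split; first split.
- move=> [x a] fx; have Ih := integrable_density_bound fx.
  (* The axioms must hold at every probability; away from [Q (x, a)] evaluation at [point] satisfies
     them. *)
  pose nu v (mu : probability X R) : \bar R :=
    if pselect (mu = Q (x, a)) then (entropic_envelope (x, a) v)%:E
    else (v point)%:E.
  exists nu => [mu|v _]; last by rewrite /nu; case: pselect.
  rewrite /nu; case: pselect => h /=; split.
  + move=> u v wu wv vu; rewrite lee_fin.
    by apply: robust_mono => //; exact: adm.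
  + move=> v r wv; rewrite -EFinD; congr EFin.
    by apply: robust_translation => //; exact: adm.
  + by congr EFin; exact: robust0.
  + by move=> u v _ _ vu; rewrite lee_fin.
  + by [].
  + by [].
- by move=> v vw; exact: measurable_entropic_envelope vw.
- move=> [x a] u v t fx wu wv t01; have Ih := integrable_density_bound fx.
  by apply: robust_convex => //; exact: adm.
- move=> [x a] v l fx wv l0; have Ih := integrable_density_bound fx.
  by apply: robustZ => //; exact: adm.
Qed.

(** The seminorm bound reads K (w y + w z) = 2 K + w0 y + w0 z. The diagonal is treated apart, as
    the seminorm only sees distinct points. *)
Lemma wspace_bounded_osc v :
  wspace_bounded (fun x => 1 + K^-1 * w1 x `^ p) K v ->
  forall y z, v y - v z <= 2 * K + w1 y `^ p + w1 z `^ p.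
Proof.
move=> [_ vK] y z.
have [->|/eqP yz] := eqVneq y z.
  by rewrite subrr !addr_ge0// mulr_ge0// ltW.
have ki0 : 0 <= K^-1 by rewrite invr_ge0 ltW.
have : ((`|v y - v z| / (1 + K^-1 * w1 y `^ p + (1 + K^-1 * w1 z `^ p)))%:E <= K%:E)%E.
  by apply: le_trans vK; apply: ereal_sup_ubound; exists (y, z).
rewrite lee_fin ler_pdivrMr; last first.
  by rewrite addr_gt0// ltr_pwDl// mulr_ge0.
move=> /(le_trans (ler_norm _)) /le_trans; apply.
rewrite le_eqVlt; apply/orP; left; apply/eqP; field.
by rewrite gt_eqF.
Qed.

Lemma entropic_envelope_upper :
  upper_envelope M (entropic M) (fun x => 1 + K^-1 * w1 x `^ p) K entropic_envelope.
Proof.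
have ki0 : 0 <= K^-1 by rewrite invr_ge0 ltW.
split; first exact: entropic_envelope_coherent.
move=> [x a] u v fx [wu _] bv; have [wv _] := bv.
have osc := wspace_bounded_osc bv.
have [mu [cu cu0 uc]] := wspace_growth ki0 wu.
have [mv [cv cv0 vc]] := wspace_growth ki0 wv.
have [U0 ->] := entropicE w1_meas w1_ge1 drift p01 fx mu cu0 uc.
have [V0 ->] := entropicE w1_meas w1_ge1 drift p01 fx mv cv0 vc.
have Iw1 := drift_integrable w1_meas drift fx.
have Pw1 := drift_Rintegral w1_meas drift fx.
have Iu := integrable_expR_power w1_meas w1_ge1 p01 Iw1 mu cu0 uc.
have Iv := integrable_expR_power w1_meas w1_ge1 p01 Iw1 mv cv0 vc.
have Iw := integrable_expR_affine w1_meas w1_ge1 p01 Iw1 0 ler01.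
have {}Iw : (Q (x, a)).-integrable [set: X] (EFin \o (fun y => expR (w1 y `^ p))).
  by move: Iw; under eq_fun do rewrite add0r mul1r.
have INw : (Q (x, a)).-integrable [set: X] (EFin \o (fun y => expR (- w1 y `^ p))).
  apply: integrable_dominated Iw.
    by apply: measurableT_comp => //; exact: measurable_funN.
  move=> y; rewrite ger0_norm ?expR_ge0// ler_expR.
  by rewrite (le_trans _ (w0_ge0 y))// oppr_le0.
rewrite -EFinB lee_fin.
apply: (robust_envelope _ _ _ erefl) => //.
- exact: integrable_density_bound.
- exact: wspace_admissible fx ki0 wu.
- exact: wspace_admissible fx ki0 wv.
(* Upper density bound: the oscillation bound from [y] to [z] is integrated in [z] against the lower
   moment bound for [expR (- w0)]. *)
- move=> y; rewrite -ler_pdivrMr ?expR_gt0// -expRN -expRD.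
  apply: (@le_trans _ _ (\int[Q (x, a)]_z (expR (v y - (2 * K + w1 y `^ p)) *
     expR (- w1 z `^ p)))); last first.
    apply: Rintegral_le => //; first exact: integrable_EFinZ.
    move=> z; rewrite -expRD ler_expR; have := osc y z.
    by rewrite lerBlDr -lerBlDl => /(le_trans _); apply; rewrite le_eqVlt;
      apply/orP; left; apply/eqP; ring.
  rewrite RintegralZl//.
  have -> : v y - (2 * K + drift0 x + w1 y `^ p) =
    v y - (2 * K + w1 y `^ p) + - drift0 x by ring.
  rewrite expRD ler_pM2l ?expR_gt0//.
  exact: (Rintegral_expRN_power w1_meas w1_ge1 p01 Iw1 Pw1).
(* Lower density bound: the roles of [y] and [z] are exchanged, and the upper moment bound for
   [expR (w0)] is used. *)
- move=> y; apply: (@le_trans _ _ (\int[Q (x, a)]_z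
    (expR (v y + 2 * K + w1 y `^ p) * expR (w1 z `^ p)))).
    apply: Rintegral_le => //; first exact: integrable_EFinZ.
    move=> z; rewrite -expRD ler_expR; have := osc z y.
    by rewrite lerBlDr => /le_trans; apply; rewrite le_eqVlt;
      apply/orP; left; apply/eqP; ring.
  rewrite RintegralZl// -expRD.
  have -> : 2 * K + drift0 x + w1 y `^ p + v y =
    v y + 2 * K + w1 y `^ p + drift0 x by ring.
  rewrite [leRHS]expRD ler_pM2l ?expR_gt0//.
  exact: (Rintegral_expR_power w1_meas w1_ge1 p01 Iw1 Pw1).
Qed.

End upper_envelope.

(* On [delta s' <= s] with [gamma1 < delta < 1] the term [gamma1 s'] only uses a
   fraction of the budget [s], and all other terms are sublinear in [s]. *)
Lemma drift_budget (R : realType) (gamma1 K1 p : R) :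
    0 < gamma1 < 1 -> 0 < K1 -> 0 < p < 1 ->
  exists2 D, 0 <= D & forall s s' : R, 1 <= s -> 1 <= s' ->
    (1 + gamma1) / 2 * s' <= s ->
    s `^ p + s `^ p + (gamma1 * s' + K1) `^ p + (gamma1 * s' + K1) <= s + D.
Proof.
move=> /andP[g0 g1] k0 /andP[p0 p1].
pose delta := (1 + gamma1) / 2; have d0 : 0 < delta by rewrite /delta; lra.
pose kappa := gamma1 / delta.
have kappa1 : kappa < 1 by rewrite /kappa ltr_pdivrMr// mul1r /delta; lra.
(* The coefficient 3 counts the two copies of s^p and the one that bounds (gamma1 s' + K1)^p;
   [1 - kappa] is the share of [s] that gamma1 s' leaves free. *)
have [|||D D0 hD] := @powR_absorb R p 1 3 (1 - kappa); try lra.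
exists (D + K1 `^ p + K1) => [|s s' s1 s'1 ss'].
  by rewrite !addr_ge0 ?powR_ge0// ltW.
have s0 : 0 < s by lra.
have s'0 : 0 < s' by lra.
have gs : gamma1 * s' <= kappa * s.
  have -> : gamma1 * s' = kappa * (delta * s').
    by rewrite /kappa; field; rewrite gt_eqF.
  by rewrite ler_wpM2l// divr_ge0 ?ltW.
have gs' : gamma1 * s' <= s.
  by apply: (le_trans gs); rewrite -[leRHS]mul1r ler_wpM2r ?ltW.
have h1 : (gamma1 * s' + K1) `^ p <= s `^ p + K1 `^ p.
  have p01 : 0 <= p <= 1 by rewrite !ltW.
  apply: (le_trans (powR_subadditive p01 _ k0)); first by rewrite mulr_gt0.
  by rewrite lerD2r ge0_ler_powR ?nnegrE ?mulr_ge0 ?(ltW p0) ?(ltW s0) ?(ltW g0) ?(ltW s'0).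
have := hD _ s1; rewrite powRr1 ?(ltW s0)//.
move: h1 gs; move: (_ `^ p) (s `^ p) (K1 `^ p) => *; lra.
Qed.

(** * Drift (B1) and minorization (B2) of the envelope *)

Section envelope_drift.
Context (R : realType) (dX dA : measure_display).
Context (X : measurableType dX) (A : measurableType dA).
Variables (M : markov_control_process R X A) (w1 : X -> R) (gamma1 K1 p K : R).
Hypotheses (w1_meas : measurable_fun [set: X] w1) (w1_ge1 : forall x, 1 <= w1 x).
Hypotheses (gamma1_01 : 0 < gamma1 < 1) (K1_gt0 : 0 < K1).
Hypothesis drift : forall x a, feasible M x a ->
  (entropic M (x, a) w1 <= (gamma1 * w1 x + K1)%:E)%E.
Hypotheses (p01 : 0 < p < 1) (K_gt0 : 0 < K).
Implicit Types (v u : X -> R) (c r k : R).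

Local Notation Q := (transition M).
Local Notation w0 := (fun x => w1 x `^ p).
Local Notation drift0 x := ((gamma1 * w1 x + K1) `^ p).
Local Notation h := (density_bound w1 gamma1 K1 p K).
Local Notation rhobar := (entropic_envelope M w1 gamma1 K1 p K).

Let p_gt0 : 0 < p. Proof. by case/andP : p01. Qed.
Let w1_gt0 x : 0 < w1 x. Proof. exact: lt_le_trans (w1_ge1 x). Qed.
Let w0_ge0 x : 0 <= w1 x `^ p. Proof. exact: powR_ge0. Qed.

Let mw0 : measurable_fun [set: X] w0.
Proof. exact: measurable_power. Qed.

Lemma entropic_envelope_drift : exists gamma Kbar : R,
  [/\ 0 < gamma < 1, 0 < Kbar & forall x a, feasible M x a ->
    rhobar (x, a) w0 <= gamma * w1 x `^ p + Kbar].
Proof.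
have [D D0 hD] := drift_budget gamma1_01 K1_gt0 p01.
have d01 : 0 < (1 + gamma1) / 2 < 1 by case/andP : gamma1_01 => *; lra.
move: hD d01; move: ((1 + gamma1) / 2) => delta hD /andP[d0 d1].
exists (delta `^ p), (expR (2 * K + D)); split.
- rewrite powR_gt0//=; have <- : 1 `^ p = 1 :> R by rewrite powR1.
  by rewrite gt0_ltr_powR ?nnegrE// ltW.
- exact: expR_gt0.
move=> x a fx.
have Iw1 := drift_integrable w1_meas drift fx.
have Pw1 := drift_Rintegral w1_meas drift fx.
have aw : admissible (Q (x, a)) (h x) w0.
  apply: (admissible_power w1_meas w1_ge1 p01 Iw1 _ mw0 ler01) => y.
  by rewrite ger0_norm// mul1r lerDr.
have h1 y : 1 <= h x y by exact: density_bound_ge1.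
have mh : measurable_fun [set: X] (h x) by exact: measurable_density_bound.
have ih : (Q (x, a)).-integrable [set: X] (EFin \o h x).
  exact: integrable_density_bound.
(* With this shift the additive part of the objective is exactly the linear term of the claim; the
   integral then only needs a constant bound. *)
pose t := delta `^ p * w1 x `^ p.
apply: (le_trans (robust_le mh h1 ih t aw)); rewrite lerD2l.
(* Scaled so that the drift condition bounds the integral of [B * expR (w1 y)] by
   [expR (2 * K + D)]. *)
pose B := expR (2 * K + D - (gamma1 * w1 x + K1)).
apply: (@le_trans _ _ (\int[Q (x, a)]_y (B * expR (w1 y)))).
  apply: Rintegral_le.
  - apply: (stretch_integrable mh h1 (f := fun y => w1 y `^ p - t)).
    by apply: admissibleB => //; exact: admissible_cst.
  - exact: integrable_EFinZ.
  move=> y; have [yt|ty] := leP (w1 y `^ p) t.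
    rewrite le0_stretch ?subr_le0//.
    apply: (@le_trans _ _ 0); last by rewrite mulr_ge0 ?expR_ge0.
    by rewrite mulr_ge0_le0 ?subr_le0// invr_ge0 expR_ge0.
  have xy : delta * w1 x <= w1 y.
    rewrite leNgt; apply/negP => yx; move: ty; rewrite ltNge => /negP; apply.
    rewrite /t -powRM ?(ltW d0) ?(ltW (w1_gt0 x))//.
    by rewrite ge0_ler_powR ?nnegrE ?mulr_ge0 ?(ltW p_gt0) ?(ltW d0) ?(ltW (w1_gt0 _))// ltW.
  rewrite ge0_stretch ?subr_ge0 ?(ltW ty)//.
  have t0 : 0 <= t by rewrite mulr_ge0// powR_ge0.
  (* One copy of w0 y sits in [h x y], the other comes from w0 y - t <= exp (w0 y): these are the
     two copies of s^p in [drift_budget]. *)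
  apply: (@le_trans _ _ (h x y * expR (w1 y `^ p))).
    rewrite ler_pM2l ?expR_gt0//; apply: le_trans (expR_ge1Dx _).
    by move: (w1 y `^ p) (t) t0 => ? ? ?; lra.
  rewrite /density_bound /B -!expRD ler_expR.
  have := hD _ _ (w1_ge1 y) (w1_ge1 x) xy.
  by move: (w1 y `^ p) (drift0 x) => ? ?; lra.
rewrite RintegralZl// /B expRD -mulrA -[leRHS]mulr1 ler_pM2l ?expR_gt0//.
by rewrite expRN mulrC ler_pdivrMr ?expR_gt0// mul1r.
Qed.

Lemma entropic_envelope_minorization (gamma Kbar : R) : local_doeblin M w1 ->
  exists (alpha : R) (mu : probability X R) (r : R),
    [/\ 0 < alpha < 1,
        (\int[mu]_y (w1 y `^ p)%:E < +oo)%E,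
        2 * Kbar / (1 - gamma) < r &
        forall x a u v, w1 x `^ p <= r -> feasible M x a ->
          wspace (fun z => 1 + w1 z `^ p) u -> wspace (fun z => 1 + w1 z `^ p) v ->
          (forall z, u z <= v z) ->
          (alpha%:E * \int[mu]_y (v y - u y)%:E
             <= (rhobar (x, a) v - rhobar (x, a) u)%:E)%E].
Proof.
move=> doeblin.
(* The second argument puts [point] in the level set. *)
pose r := Num.max (2 * Kbar / (1 - gamma) + 1) (w1 point `^ p).
have rK : 2 * Kbar / (1 - gamma) < r by rewrite lt_max ltrDl ltr01.
have pr : w1 point `^ p <= r by rewrite le_max lexx orbT.
clearbody r.
have r0 : 0 <= r by exact: le_trans pr.
pose L := r `^ p^-1; pose C := [set z | w1 z <= L].
have inC x : w1 x `^ p <= r -> w1 x <= L by exact: power_level.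
have mC : measurable C by exact: level_measurable.
have [|k k0 [kQ QC]] := @doeblin_ratio _ _ _ _ _ M w1 w1_ge1 L doeblin.
  by exists point; exact: inC.
(* The transition probability from [point] under [a0], conditioned on [C], serves as reference;
   [doeblin_ratio] compares every other kernel with it. *)
have [a0 fa0] := feasible_neq0 M point.
have QC0 := QC _ _ (inC _ pr) fa0.
have [mu muE] := conditional_probability mC QC0.
have QCfin : Q (point, a0) C \is a fin_num by exact: fin_num_measure.
pose q0 := fine (Q (point, a0) C).
have q0_gt0 : 0 < q0 by rewrite fine_gt0// QC0/= ltey_eq QCfin.
have muCc : mu (~` C) = 0%E.
  have := muE _ (measurableC mC); rewrite setICl measure0 => /eqP.
  by rewrite mule_eq0 gt_eqF//= => /eqP.
have muint (f : X -> \bar R) : (forall y, 0 <= f y)%E -> measurable_fun [set: X] f ->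
    (\int[mu]_y f y = \int[mu]_(y in C) f y)%E.
  move=> f0 mf; rewrite -(setUv C) ge0_integral_setU//; last 3 first.
  - exact: measurableC.
  - by rewrite setUv.
  - by apply/disj_setPS; rewrite setICr.
  rewrite [X in (_ + X)%E]null_set_integral ?adde0//; first exact: measurableC.
  exact: measurable_funS mf.
(* A bound for the exponent of [h x y] when both points lie in [C], so that the slopes there are at
   least [expR (- b)]. *)
pose b := 2 * K + (gamma1 * L + K1) `^ p + L `^ p.
pose alpha0 := k * q0 * expR (- b).
have alpha0_gt0 : 0 < alpha0 by rewrite !mulr_gt0 ?expR_gt0.
(* The minimum with 1/2 only enforces [alpha < 1]. *)
exists (Num.min alpha0 2^-1), mu, r; split => //.
- rewrite lt_min alpha0_gt0 gt_min; apply/andP; split; last apply/orP; lra.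
- rewrite muint//; last exact/measurable_EFinP.
  apply: (@le_lt_trans _ _ (\int[mu]_(y in C) (L `^ p)%:E)%E).
    apply: ge0_le_integral => //.
    + by move=> y _; rewrite lee_fin.
    + by apply/measurable_EFinP; exact: measurable_funTS.
    + move=> y Cy; rewrite lee_fin ge0_ler_powR ?nnegrE ?powR_ge0 ?(ltW p_gt0)//.
      exact: ltW.
  rewrite integral_cst//= -[mu C]fineK ?fin_num_measure//.
  by rewrite -EFinM ltry.
move=> x a u v xr fx wu wv uv.
have Iw1 := drift_integrable w1_meas drift fx.
have h1 y : 1 <= h x y by exact: density_bound_ge1.
have mh : measurable_fun [set: X] (h x) by exact: measurable_density_bound.
have ih : (Q (x, a)).-integrable [set: X] (EFin \o h x).
  exact: integrable_density_bound.
have adm f : wspace (fun z => 1 + w1 z `^ p) f -> admissible (Q (x, a)) (h x) f.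
  move=> wf; apply: (wspace_admissible K w1_meas w1_ge1 drift p01 fx ler01).
  by under eq_fun do rewrite mul1r.
have au := adm _ wu; have av := adm _ wv; have avu := admissibleB av au.
have [mf _] := avu.
have f0 y : 0 <= v y - u y by rewrite subr_ge0.
have Ivu := admissible_integrable h1 avu.
(* By [robust_incr] the envelope grows at least by this integral; what remains is to restrict it to
   [C] and compare kernels there. *)
apply: (@le_trans _ _ (\int[Q (x, a)]_y ((h x y)^-1 * (v y - u y)))%:E); last first.
  by rewrite lee_fin lerBrDl; exact: robust_incr.
rewrite muint; [|by move=> y; rewrite lee_fin|exact/measurable_EFinP].
have cmp : ((k * q0)%:E * \int[mu]_(y in C) (v y - u y)%:E <=
    \int[Q (x, a)]_(y in C) (v y - u y)%:E)%E.
  apply: ge0_le_integral_within => //.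
  - by rewrite mulr_ge0 ?ltW.
  - move=> D mD; rewrite EFinM -muleA fineK// muE; last exact: measurableI.
    by rewrite -setIA setIid; apply: kQ => //; exact: inC.
  - exact/measurable_EFinP.
apply: (@le_trans _ _ (alpha0%:E * \int[mu]_(y in C) (v y - u y)%:E)%E).
  apply: lee_wpmul2r; first by apply: integral_ge0 => y _; rewrite lee_fin.
  by rewrite lee_fin ge_min lexx.
rewrite /alpha0 (mulrC (k * q0)) EFinM -muleA.
apply: (@le_trans _ _ ((expR (- b))%:E *
    \int[Q (x, a)]_(y in C) (v y - u y)%:E)%E).
  by rewrite lee_pmul2l// lte_fin expR_gt0.
rewrite (integral_patch mC Ivu) -EFinM lee_fin -RintegralZl//; last exact: integrable_patch.
apply: Rintegral_le.
- by apply: integrable_EFinZ; exact: integrable_patch.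
- exact: (admissible_div mh h1 avu).
move=> y; rewrite patchE; case: ifPn => [|_]; last first.
  by rewrite mulr0 mulr_ge0// invr_ge0 expR_ge0.
rewrite inE => Cy; rewrite ler_wpM2r// /density_bound -expRN ler_expR lerN2.
rewrite /b !lerD//.
- exact: (drift0_mono w1_ge1 gamma1_01 K1_gt0 p01 (inC _ xr)).
- rewrite ge0_ler_powR ?nnegrE ?powR_ge0 ?(ltW p_gt0)//.
  exact: ltW.
Qed.

End envelope_drift.

Unset Implicit Arguments.

Theorem theorem4p10 (R : realType) (dX dA : measure_display)
    (X : measurableType dX) (A : measurableType dA)
    (M : markov_control_process R X A)
    (w1 : X -> R) (gamma1 K1 q C : R)
    (w1_meas : measurable_fun [set: X] w1)
    (w1_ge1 : forall x, 1 <= w1 x)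
    (gamma1_01 : 0 < gamma1 < 1)
    (K1_gt0 : 0 < K1)
    (drift : forall x a, feasible M x a ->
      (entropic M (x, a) w1 <= (gamma1 * w1 x + K1)%:E)%E)
    (doeblin : local_doeblin M w1)
    (q_01 : 0 < q < 1)
    (C_gt0 : 0 < C)
    (cost_bound : forall x a, feasible M x a ->
      `|cost M (x, a)| <= C * w1 x `^ q)
    (p : R) (p_q1 : q < p < 1) :
  let w0 : X -> R := fun x => w1 x `^ p in
  let T : X * A -> (X -> R) -> \bar R :=
    fun xa v => ((cost M xa)%:E + entropic M xa v)%E in
  exists gamma0 K0 K : R,
  [/\ 0 < gamma0 < 1, 0 < K0, K0 < K &
  [/\ (* A1 *)
      forall x a, feasible M x a ->
        (Order.max (T (x, a) w0) (- T (x, a) (fun z => - w0 z)%R)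
           <= (gamma0 * w0 x + K0)%:E)%E,
      (* A2 *)
      forall (v : X -> R) x y a b,
        wspace (fun z => 1 + w0 z) v -> (forall z, `|v z| <= w0 z + K) ->
        w0 x <= 2 * K0 / (1 - gamma0) -> w0 y <= 2 * K0 / (1 - gamma0) ->
        feasible M x a -> feasible M y b ->
        ((2 * K0)%:E <=
           entropic M (x, a) (fun z => w0 z + K)%R - entropic M (x, a) v
           + entropic M (y, b) v - entropic M (y, b) (fun z => - w0 z - K)%R)%E &
      let w : X -> R := fun x => 1 + K^-1 * w0 x in
      exists (gamma Kbar : R) (rhobar : X * A -> (X -> R) -> R),
      [/\ 0 < gamma < 1, 0 < Kbar,
          upper_envelope M (entropic M) w K rhobar,
          (* B1 *)
          forall x a, feasible M x a -> rhobar (x, a) w0 <= gamma * w0 x + Kbar &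
          (* B2 *)
          exists (alpha : R) (mu : probability X R) (r : R),
          [/\ 0 < alpha < 1,
              (\int[mu]_y (w0 y)%:E < +oo)%E,
              2 * Kbar / (1 - gamma) < r &
              forall x a (u v : X -> R), w0 x <= r -> feasible M x a ->
                wspace (fun z => 1 + w0 z) u -> wspace (fun z => 1 + w0 z) v ->
                (forall z, u z <= v z) ->
                (alpha%:E * \int[mu]_y (v y - u y)%:E
                   <= (rhobar (x, a) v - rhobar (x, a) u)%:E)%E]]]].
Proof.
move=> w0 T.
have [q0 [qp p1]] : 0 < q /\ q < p /\ p < 1.
  by case/andP : q_01 => ? _; case/andP : p_q1.
have p01 : 0 < p < 1 by rewrite p1 (lt_trans q0).
have q0p : 0 <= q < p by rewrite qp ltW.
have [gamma0 [K0 [g01 K0_gt0 hA1]]] :=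
  entropic_drift w1_meas w1_ge1 gamma1_01 K1_gt0 drift p01 q0p (ltW C_gt0) cost_bound.
have [K K0K hA2] := entropic_minorization w1_meas w1_ge1 gamma1_01 K1_gt0 drift p01
  doeblin g01 K0_gt0.
have K_gt0 : 0 < K by exact: lt_trans K0K.
have [gamma [Kbar [gam01 Kbar_gt0 hB1]]] :=
  entropic_envelope_drift w1_meas w1_ge1 gamma1_01 K1_gt0 drift p01 K_gt0.
exists gamma0, K0, K; split => //; split => // w.
exists gamma, Kbar, (entropic_envelope M w1 gamma1 K1 p K); split => //.
  exact: entropic_envelope_upper.
exact: entropic_envelope_minorization.
Qed.
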